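(* Let $A,B\subset\mathbb{R}^n$ be closed solid convex sets with $A\cap B\neq\emptyset$, and consider the GAP iteration $x_{k+1}=\Pi_A^{\alpha_2}\Pi_B^{\alpha_1}x_k$ (i.e. $\alpha=1$) with $1<\alpha_1,\alpha_2<2$. Then the iterates converge to some point $x^*\in A\cap B$. If moreover $(A,B)$ satisfies condition (C) at $x^*$, then either the problem is solved in finite time (some $x_k\in A\cap B$), or $x^*\in\operatorname{bd}A\cap\operatorname{bd}B$ and eventually the algorithm identifies $(\operatorname{bd}A,\operatorname{bd}B)$, i.e. there is $K$ such that for all $k\ge K$ the iterates coincide with those obtained when $A$ and $B$ are replaced by $\operatorname{bd}A$ and $\operatorname{bd}B$, and the iterates converge R-linearly to $x^*$ with any rate $\mu\in(\gamma(S_{T(x^* )}),1)$, where $S_{T(x^* )}:=\Pi^{\alpha_2}_{T_{\operatorname{bd}A}(x^* )}\Pi^{\alpha_1}_{T_{\operatorname{bd}B}(x^* )}$.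
   Context: Solid means nonempty interior. $\Pi_C$ is the projection onto $C$, $\Pi_C^\alpha:=(1-\alpha)I+\alpha\Pi_C$. A set $\mathcal{M}$ is a $\mathcal{C}^k$-manifold around $x$ if there is an open $U\ni x$ with $\mathcal{M}\cap U=\{y:F(y)=0\}$ for a $\mathcal{C}^k$ map $F:U\to\mathbb{R}^d$ with surjective derivative throughout $U$; $T_{\mathcal{M}}(x)=\ker DF(x)$. Two manifolds $\mathcal{M},\mathcal{N}$ satisfy the regularity assumption at $x\in\mathcal{M}\cap\mathcal{N}$ if they are $\mathcal{C}^k$-smooth ($k\ge2$) around $x$, $\mathcal{M}\cap\mathcal{N}$ is a $\mathcal{C}^k$ manifold around $x$, and $T_{\mathcal{M}\cap\mathcal{N}}(x)=T_{\mathcal{M}}(x)\cap T_{\mathcal{N}}(x)$. Condition (C) at $x^*\in A\cap B$: at least one of (C1) $x^*\in\operatorname{bd}A\cap\operatorname{bd}B$ and $(\operatorname{bd}A,\operatorname{bd}B)$ satisfy the regularity assumption at $x^*$; (C2) $x^*\in\operatorname{int}A\cap\operatorname{bd}B$ with $\operatorname{bd}B$ a $\mathcal{C}^2$ manifold around $x^*$; (C3) $x^*\in\operatorname{bd}A\cap\operatorname{int}B$ with $\operatorname{bd}A$ a $\mathcal{C}^2$ manifold around $x^*$; (C4) $x^*\in\operatorname{int}A\cap\operatorname{int}B$. For a matrix $M$ with spectral radius at most $1$, $\gamma(M):=\max\{|\lambda| : \lambda\in\{0\}\cup(\Lambda(M)\setminus\{1\})\}$, $\Lambda(M)$ the set of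 eigenvalues. R-linear convergence with any rate $\mu\in(\gamma,1)$: for every such $\mu$ there is $C>0$ with $\|x_k-x^*\|\le C\mu^k$ for all $k$. *)

(* Defs.v *)
From HB Require Import structures.
From mathcomp Require Import all_boot all_order all_algebra.
From mathcomp Require Import all_classical all_reals topology normedtype derive.
From mathcomp Require Import complex.
Set Implicit Arguments. Unset Strict Implicit. Unset Printing Implicit Defensive.
Import Order.TTheory GRing.Theory Num.Theory.
Import numFieldNormedType.Exports.
Local Open Scope classical_set_scope.
Local Open Scope ring_scope.

Section Defs.
Variables (R : realType) (n : nat).
Local Notation vec := 'rV[R]_n.

Definition dotv (u v : vec) : R := \sum_(i < n) u 0 i * v 0 i.
Definition enorm (u : vec) : R := Num.sqrt (dotv u u).

Definition bd (A : set vec) : set vec := closure A `\` A°.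

Definition convex_set (A : set vec) : Prop :=
  forall x y (t : R), A x -> A y -> 0 <= t <= 1 -> A ((1 - t) *: x + t *: y).

Definition solid (A : set vec) : Prop := exists x, A° x.

Definition is_proj (C : set vec) (x p : vec) : Prop :=
  C p /\ forall y, C y -> enorm (x - p) <= enorm (x - y).

(* the projection Pi_C (a chosen nearest point; unique for closed convex nonempty C) *)
Definition projC (C : set vec) (x : vec) : vec := xget 0 [set p | is_proj C x p].

Definition relax (a : R) (P : vec -> vec) (x : vec) : vec := (1 - a) *: x + a *: P x.

End Defs.

Fixpoint Ck (R : realType) (n d : nat) (k : nat) (U : set 'rV[R]_n)
    (f : 'rV[R]_n -> 'rV[R]_d) : Prop :=
  match k with
  | 0 => forall x, U x -> f @ x --> f x
  | k'.+1 => (forall x, U x -> differentiable f x) /\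
             forall v : 'rV[R]_n, Ck k' U (fun x => 'D_v f x)
  end.

Definition is_chart (R : realType) (n : nat) (k : nat) (M : set 'rV[R]_n)
    (x : 'rV[R]_n) (U : set 'rV[R]_n) (d : nat) (F : 'rV[R]_n -> 'rV[R]_d) : Prop :=
  [/\ open U, U x, Ck k U F,
      (forall y, U y -> forall w : 'rV[R]_d, exists v, 'd F y v = w) &
      (forall y, U y -> (M y <-> F y = 0))].

Definition manifold (R : realType) (n : nat) (k : nat) (M : set 'rV[R]_n)
    (x : 'rV[R]_n) : Prop :=
  exists U d (F : 'rV[R]_n -> 'rV[R]_d), is_chart k M x U F.

(* tangent space T_M(x) = ker DF(x) *)
Definition tker (R : realType) (n d : nat) (F : 'rV[R]_n -> 'rV[R]_d)
    (x : 'rV[R]_n) : set 'rV[R]_n := [set v | 'd F x v = 0].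

Definition regular_pair (R : realType) (n : nat) (M N : set 'rV[R]_n)
    (x : 'rV[R]_n) : Prop :=
  exists k, (2 <= k)%N /\
    exists UM dM (FM : 'rV[R]_n -> 'rV[R]_dM),
    exists UN dN (FN : 'rV[R]_n -> 'rV[R]_dN),
    exists UI dI (FI : 'rV[R]_n -> 'rV[R]_dI),
      [/\ is_chart k M x UM FM, is_chart k N x UN FN,
          is_chart k (M `&` N) x UI FI &
          tker FI x = tker FM x `&` tker FN x].

Definition condC (R : realType) (n : nat) (A B : set 'rV[R]_n)
    (x : 'rV[R]_n) : Prop :=
  [\/ (bd A x /\ bd B x /\ regular_pair (bd A) (bd B) x),
      (A° x /\ bd B x /\ manifold 2 (bd B) x),
      (bd A x /\ B° x /\ manifold 2 (bd A) x) |
      (A° x /\ B° x)].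

(* matrix (row-vector convention: v *m mat_of f = f v) of a linear map *)
Definition mat_of (R : realType) (n : nat) (f : 'rV[R]_n -> 'rV[R]_n) : 'M[R]_n :=
  \matrix_(i, j) f (delta_mx 0 i) 0 j.

Definition cmod (R : realType) (z : R[i]) : R :=
  Num.sqrt (complex.Re z ^+ 2 + complex.Im z ^+ 2).

Definition gamma (R : realType) (n : nat) (M : 'M[R]_n) : R :=
  sup [set r : R | r = 0 \/
         exists l : R[i], eigenvalue (map_mx (fun a : R => a%:C%C) M) l
                          /\ l != 1 /\ r = cmod l].

Definition S_T (R : realType) (n : nat) (a1 a2 : R) (TA TB : set 'rV[R]_n) :
  'rV[R]_n -> 'rV[R]_n := fun v => relax a2 (projC TA) (relax a1 (projC TB) v).

(* Main.v *)
(* The relaxed projections are Fejer monotone, which gives x_k -> xs in A `&` B.  When bd C is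
   given near xs by a chart F, a two-dimensional argument shows that F has rank one, and the
   intermediate value theorem along the normal direction shows that the unit normals
   (z - P_C z) / |z - P_C z| converge, as z -> xs from outside C, to a unit vector u with
   ker DF(xs) = u^perp.  Hence over-relaxed steps taken near xs land in C: either some x_k is in
   A `&` B, or eventually every projection is taken from strictly outside, onto the boundary.
   In the second case put al_k = d(y_k, A), be_k = d(x_k, B) and kap = - <uA, uB>, where
   y_k is the intermediate point.  Convexity and the convergence of the normals give
     al_(k+1) = a1 kap be_(k+1) - (a2 - 1) al_k + o(al_k + be_(k+1)),
     be_(k+1) = a2 kap al_k - (a1 - 1) be_k + o(al_k + be_k).
   Since all these distances are positive, the ratios al_(k+1) / al_k eventually lie below any
   mu that dominates the positive roots of
     (l + a1 - 1) (l + a2 - 1) = a1 a2 kap^2 l,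
   and for kap < 1 these roots are eigenvalues of S_T different from 1.  If kap = 1, regularity
   makes both boundaries coincide with one hyperplane near xs and the recursion is exact, with
   factor (a1 - 1) (a2 - 1), again an eigenvalue of S_T. *)

Require Import Defs.
From HB Require Import structures.
From mathcomp Require Import all_boot all_order all_algebra.
From mathcomp Require Import all_classical all_reals topology normedtype derive.
From mathcomp Require Import complex.
From mathcomp Require Import landau zify ring lra.
Set Implicit Arguments. Unset Strict Implicit. Unset Printing Implicit Defensive.
Import Order.TTheory GRing.Theory Num.Theory.
Import numFieldNormedType.Exports.
Local Open Scope classical_set_scope.
Local Open Scope ring_scope.

(** * Euclidean geometry of row vectors *)

Section Euclid.
Context {R : realType} {n : nat}.
Implicit Types (u v w x y z : 'rV[R]_n) (a : R).

Lemma dotvC u v : dotv u v = dotv v u.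
Proof. by apply: eq_bigr => i _; rewrite mulrC. Qed.

Lemma dotvDl u v w : dotv (u + v) w = dotv u w + dotv v w.
Proof. by rewrite -big_split; apply: eq_bigr => i _; rewrite mxE mulrDl. Qed.

Lemma dotvZl a u v : dotv (a *: u) v = a * dotv u v.
Proof. by rewrite /dotv mulr_sumr; apply: eq_bigr => i _; rewrite mxE mulrA. Qed.

Lemma dotvNl u v : dotv (- u) v = - dotv u v.
Proof. by rewrite -scaleN1r dotvZl mulN1r. Qed.

Lemma dotvBl u v w : dotv (u - v) w = dotv u w - dotv v w.
Proof. by rewrite dotvDl dotvNl. Qed.

Lemma dotvDr u v w : dotv w (u + v) = dotv w u + dotv w v.
Proof. by rewrite dotvC dotvDl !(dotvC w). Qed.

Lemma dotvZr a u v : dotv u (a *: v) = a * dotv u v.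
Proof. by rewrite dotvC dotvZl dotvC. Qed.

Lemma dotvNr u v : dotv u (- v) = - dotv u v.
Proof. by rewrite dotvC dotvNl dotvC. Qed.

Lemma dotvBr u v w : dotv w (u - v) = dotv w u - dotv w v.
Proof. by rewrite dotvDr dotvNr. Qed.

Definition dotvE :=
  (dotvDl, dotvDr, dotvNl, dotvNr, dotvZl, dotvZr).

Lemma dotv_subZ a u v :
  dotv (u - a *: v) (u - a *: v) = dotv u u - 2 * a * dotv u v + a ^+ 2 * dotv v v.
Proof. by rewrite !dotvE (dotvC v u); ring. Qed.

Lemma dotvv_ge0 u : 0 <= dotv u u.
Proof. by apply: sumr_ge0 => i _; rewrite -expr2 sqr_ge0. Qed.

Lemma dotvv_eq0 u : dotv u u = 0 -> u = 0.
Proof.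
move=> /eqP; rewrite psumr_eq0; last by move=> i _; rewrite -expr2 sqr_ge0.
move=> /allP u0; apply/rowP => i; rewrite mxE.
by have := u0 i (mem_index_enum _); rewrite /= mulf_eq0 orbb => /eqP.
Qed.

Lemma enorm_ge0 u : 0 <= enorm u. Proof. exact: sqrtr_ge0. Qed.

Lemma enorm_sqr u : enorm u ^+ 2 = dotv u u.
Proof. by rewrite sqr_sqrtr// dotvv_ge0. Qed.

Lemma enorm_le u a : 0 <= a -> dotv u u <= a ^+ 2 -> enorm u <= a.
Proof.
move=> a0 ua; rewrite -(@ler_pXn2r _ 2)// ?nnegrE ?enorm_ge0//.
by rewrite enorm_sqr.
Qed.

Lemma enorm0 : enorm (0 : 'rV[R]_n) = 0.
Proof.
rewrite /enorm (_ : dotv 0 0 = 0) ?sqrtr0//.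
by rewrite -(scale0r 0) dotvZl mul0r.
Qed.

Lemma enorm_eq0 u : enorm u = 0 -> u = 0.
Proof. by move=> u0; apply: dotvv_eq0; rewrite -enorm_sqr u0 expr0n. Qed.

Lemma enorm_gt0 u : u != 0 -> 0 < enorm u.
Proof.
move=> u0; rewrite lt_neqAle enorm_ge0 andbT eq_sym.
by apply: contra u0 => /eqP/enorm_eq0 ->.
Qed.

Lemma enormZ a u : enorm (a *: u) = `|a| * enorm u.
Proof. by rewrite /enorm dotvZl dotvZr mulrA -expr2 sqrtrM ?sqr_ge0// sqrtr_sqr. Qed.

Lemma enormN u : enorm (- u) = enorm u.
Proof. by rewrite -scaleN1r enormZ normrN1 mul1r. Qed.

Lemma enormC u v : enorm (u - v) = enorm (v - u).
Proof. by rewrite -enormN opprB. Qed.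

Lemma dotv_le u v : dotv u v <= enorm u * enorm v.
Proof.
have [->|u0] := eqVneq u 0.
  by rewrite enorm0 mul0r -(scale0r 0) dotvZl mul0r.
have [->|v0] := eqVneq v 0.
  by rewrite enorm0 mulr0 -(scale0r 0) dotvZr mul0r.
have eu := enorm_gt0 u0; have ev := enorm_gt0 v0.
have := dotvv_ge0 (enorm v *: u - enorm u *: v).
rewrite !dotvE (dotvC v u) -!enorm_sqr => h.
have : 0 <= 2 * (enorm u * enorm v) * (enorm u * enorm v - dotv u v) by nra.
by rewrite pmulr_rge0 ?subr_ge0// !mulr_gt0.
Qed.

Lemma dotv_abs u v : `|dotv u v| <= enorm u * enorm v.
Proof.
rewrite ler_norml dotv_le andbT lerNl -dotvNl.
by rewrite (le_trans (dotv_le _ _))// enormN.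
Qed.

Lemma enormD u v : enorm (u + v) <= enorm u + enorm v.
Proof.
apply: enorm_le; first by rewrite addr_ge0 ?enorm_ge0.
rewrite !dotvE (dotvC v u) -!enorm_sqr.
by have := dotv_le u v; nra.
Qed.

Lemma enorm_triangle v u w : enorm (u - w) <= enorm (u - v) + enorm (v - w).
Proof. by rewrite (le_trans _ (enormD _ _))// addrA subrK. Qed.

Lemma coord_le_enorm u i : `|u 0 i| <= enorm u.
Proof.
rewrite -(@ler_pXn2r _ 2)// ?nnegrE ?enorm_ge0// enorm_sqr real_normK ?num_real//.
rewrite /dotv (bigD1 i)//= -expr2 lerDl.
by apply: sumr_ge0 => j _; rewrite -expr2 sqr_ge0.
Qed.

Lemma norm_le_enorm u : `|u| <= enorm u.
Proof.
rewrite [leLHS]/Num.Def.normr /= mx_normrE; apply: bigmax_le; first exact: enorm_ge0.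
by move=> [i j] _; rewrite ord1; exact: coord_le_enorm.
Qed.

Lemma enorm_le_norm u : enorm u <= n.+1%:R * `|u|.
Proof.
apply: enorm_le; first by rewrite mulr_ge0.
have : dotv u u <= \sum_(i < n) `|u| ^+ 2.
  apply: ler_sum => i _; rewrite -expr2 -real_normK ?num_real// lerXn2r ?nnegrE//.
  by rewrite [leRHS]/Num.Def.normr /= mx_normrE; apply: (le_bigmax _ _ (0, i)).
move=> /le_trans; apply.
rewrite sumr_const card_ord -[leLHS]mulr_natl exprMn ler_wpM2r ?sqr_ge0// -natrX ler_nat.
by rewrite expnS expn1 mulSn; lia.
Qed.

(** The topology on row vectors is that of the max norm. The two norm comparisons above show that
    Euclidean balls form a base of it, so epsilon arguments can be run in [enorm]; the factor [n.+1]
    stays positive in dimension 0. *)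
Lemma nbhs_enorm (x : 'rV[R]_n) (U : set 'rV[R]_n) :
  nbhs x U <-> exists2 r, 0 < r & forall y, enorm (y - x) < r -> U y.
Proof.
split=> [/nbhs_ballP[r /= r0 rU]|[r r0 rU]].
  exists r => // y yr; apply: rU; rewrite -ball_normE /= -normrN opprB.
  exact: le_lt_trans (norm_le_enorm _) yr.
apply/nbhs_ballP; exists (r / n.+1%:R); first by rewrite /= divr_gt0.
move=> y; rewrite -ball_normE /= -normrN opprB ltr_pdivlMr// mulrC => yr.
by apply: rU; exact: le_lt_trans (enorm_le_norm _) yr.
Qed.

Lemma closed_enorm (C : set 'rV[R]_n) x : closed C ->
  (forall r, 0 < r -> exists2 y, C y & enorm (y - x) < r) -> C x.
Proof.
move=> cC h; apply: cC => U /nbhs_enorm[r r0 rU].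
by have [y Cy yr] := h r r0; exists y; split => //; exact: rU.
Qed.

Lemma interior_enorm (C : set 'rV[R]_n) x :
  C° x <-> exists2 r, 0 < r & forall y, enorm (y - x) < r -> C y.
Proof. exact: nbhs_enorm. Qed.

Lemma continuous_enorm_sub v : continuous (fun x => enorm (v - x)).
Proof.
move=> x; apply/(@cvgrPdist_lt _ _ _ (nbhs x)) => e e0; apply/nbhs_enorm; exists e => // y yxe.
have := enorm_triangle y v x; have := enorm_triangle x v y.
by rewrite (enormC x y) ltr_norml; lra.
Qed.

Lemma bounded_enorm_compact (C : set 'rV[R]_n) x r :
  closed C -> (forall y, C y -> enorm (x - y) <= r) -> compact C.
Proof.
move=> cC Cr; apply: bounded_closed_compact => //.
exists (enorm x + r); split; first exact: num_real.
move=> M ltM y Cy; apply: (le_trans (norm_le_enorm _)).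
have := enorm_triangle x 0 y; have := Cr y Cy; rewrite !sub0r !enormN; lra.
Qed.

End Euclid.

(** * Projections onto closed convex sets *)

Section Projection.
Context {R : realType} {n : nat}.
Implicit Types (C : set 'rV[R]_n) (u v x y z p q c : 'rV[R]_n) (a d : R).

Definition closed_convex C := [/\ closed C, convex_set C & C !=set0].

Lemma closed_enorm_ball x a : closed [set y | enorm (x - y) <= a].
Proof.
apply: (@closed_comp _ _ (fun y => enorm (x - y)) [set t | t <= a]).
  by move=> y _; exact: continuous_enorm_sub.
exact: closed_le.
Qed.

Lemma projC_is_proj C x : closed_convex C -> is_proj C x (projC C x).
Proof.
move=> [cC _ [c Cc]]; suff [p pP] : exists p, is_proj C x p by exact: (xgetPex 0 (ex_intro _ p pP)).
pose D := C `&` [set y | enorm (x - y) <= enorm (x - c)].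
have cD : closed D by apply: closedI => //; exact: closed_enorm_ball.
have kD : compact D by apply: (bounded_enorm_compact (x := x) (r := enorm (x - c)) cD) => y [].
have D0 : D !=set0 by exists c; split => /=.
have ctD : {within D, continuous (fun y => enorm (x - y))}.
  by apply: continuous_subspaceT; exact: continuous_enorm_sub.
have [p] := compact_EVT_min D0 kD ctD; rewrite inE => -[Cp px] pmin.
exists p; split => // y Cy; have [yx|/ltW xy] := leP (enorm (x - y)) (enorm (x - c)).
  by apply: pmin; rewrite inE; split.
exact: le_trans px xy.
Qed.

Lemma projC_in C x : closed_convex C -> C (projC C x).
Proof. by move=> /(projC_is_proj x) []. Qed.

(** If the angle were acute, a short step from [p] towards [y] would stay in [C] and come closer to
    [x]. *)
Lemma is_proj_obtuse C x p y : convex_set C -> is_proj C x p -> C y ->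
  dotv (x - p) (y - p) <= 0.
Proof.
move=> vC [Cp pmin] Cy; rewrite leNgt; apply/negP => d0.
set d := dotv _ _ in d0; set e := dotv (y - p) (y - p).
have e0 : 0 <= e by exact: dotvv_ge0.
(* This step length is at most 1 and satisfies [t * e < 2 * d], which makes the change of the
   squared distance, [- t * (2 * d - t * e)], negative. *)
pose t := d / (d + e).
have de : 0 < d + e by lra.
have t0 : 0 < t by rewrite divr_gt0.
have t1 : t <= 1 by rewrite ler_pdivrMr//; lra.
have tde : t * (d + e) = d by rewrite divfK// gt_eqF.
have := pmin _ (vC p y t Cp Cy _); rewrite ltW// t1 => /(_ isT).
have -> : x - ((1 - t) *: p + t *: y) = (x - p) - t *: (y - p).
  by apply/rowP => i; rewrite !mxE; ring.
rewrite -(@ler_pXn2r _ 2)// ?nnegrE ?enorm_ge0// !enorm_sqr.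
rewrite dotv_subZ -/d -/e => h.
have : t * (2 * d - t * e) <= 0 by lra.
rewrite pmulr_rle0//; nra.
Qed.

(** Expanding around [p], the obtuse angle gives [|x - q|^2 >= |x - p|^2 + |q - p|^2], so a nearest
    point [q] must be [p]. This identifies the point chosen by [xget]. *)
Lemma is_proj_unique C x p q : C p -> (forall y, C y -> dotv (x - p) (y - p) <= 0) ->
  is_proj C x q -> q = p.
Proof.
move=> Cp pP [Cq qmin]; apply/eqP; rewrite -subr_eq0; apply/eqP/dotvv_eq0.
have := pP q Cq; have := qmin p Cp.
rewrite -(@ler_pXn2r _ 2)// ?nnegrE ?enorm_ge0// !enorm_sqr.
have -> : x - q = (x - p) - (q - p) by apply/rowP => i; rewrite !mxE; ring.
have := dotvv_ge0 (q - p).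
move: (x - p) (q - p) => r s; rewrite !dotvE (dotvC s r); lra.
Qed.

Definition pdist C x := enorm (x - projC C x).

(** The unit outward normal at the projection when [x] lies outside a closed convex [C]; inside [C]
    it degenerates to 0. *)
Definition pnormal C x := (pdist C x)^-1 *: (x - projC C x).

Lemma pdist_ge0 C x : 0 <= pdist C x. Proof. exact: enorm_ge0. Qed.

Lemma projC_id C x : closed_convex C -> C x -> projC C x = x.
Proof.
move=> cC Cx; apply: (is_proj_unique Cx _ (projC_is_proj x cC)) => y _.
by rewrite subrr -(scale0r 0) dotvZl mul0r.
Qed.

Lemma projC_dist C x c : closed_convex C -> C c -> enorm (projC C x - c) <= 2 * enorm (x - c).
Proof.
move=> cC Cc; have [_ /(_ c Cc)] := projC_is_proj x cC.
have := enorm_triangle x (projC C x) c; rewrite (enormC _ x); lra.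
Qed.

Section Outside.
Variables (C : set 'rV[R]_n) (cC : closed_convex C) (x : 'rV[R]_n) (nCx : ~ C x).

Lemma pdist_gt0 : 0 < pdist C x.
Proof.
apply: enorm_gt0; rewrite subr_eq0; apply/eqP => xp; apply: nCx.
by rewrite xp; exact: projC_in.
Qed.

Lemma pnormalE : x - projC C x = pdist C x *: pnormal C x.
Proof. by rewrite scalerA divff ?scale1r// gt_eqF// pdist_gt0. Qed.

Lemma enorm_pnormal : enorm (pnormal C x) = 1.
Proof.
by rewrite enormZ ger0_norm ?invr_ge0 ?pdist_ge0// mulVf// gt_eqF// pdist_gt0.
Qed.

Lemma dotv_pnormal : dotv (pnormal C x) (pnormal C x) = 1.
Proof. by rewrite -enorm_sqr enorm_pnormal expr1n. Qed.

Lemma pnormal_le0 y : C y -> dotv (pnormal C x) (y - projC C x) <= 0.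
Proof.
move=> Cy; rewrite dotvZl pmulr_rle0 ?invr_gt0 ?pdist_gt0//.
by apply: is_proj_obtuse (projC_is_proj x cC) Cy; case: cC.
Qed.

Lemma projC_bd : bd C (projC C x).
Proof.
split; first by apply: subset_closure; exact: projC_in.
move=> /interior_enorm [r r0 rC].
(* Short enough to stay in the ball around the projection and not to overshoot [x]; moving by [s]
   along the normal would then shorten the distance. *)
set s := Num.min (r / 2) (pdist C x).
have s0 : 0 < s by rewrite lt_min pdist_gt0 divr_gt0.
have sd : s <= pdist C x by rewrite ge_min lexx orbT.
have sr : s < r by rewrite gt_min; apply/orP; left; lra.
have Cw : C (projC C x + s *: pnormal C x).
  by apply: rC; rewrite addrAC subrr add0r enormZ enorm_pnormal mulr1 ger0_norm ?ltW.
have [_ /(_ _ Cw)] := projC_is_proj x cC.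
rewrite opprD addrA pnormalE -scalerBl enormZ [in X in _ <= X -> _]enormZ enorm_pnormal !mulr1.
rewrite !ger0_norm ?subr_ge0 ?pdist_ge0//; lra.
Qed.

Lemma relax_projC a : relax a (projC C) x =
  projC C x - ((a - 1) * pdist C x) *: pnormal C x.
Proof.
have e := pnormalE; rewrite /relax -scalerA -e.
by apply/rowP => i; rewrite !mxE; ring.
Qed.

End Outside.

Lemma relax_in C a x : closed_convex C -> C x -> relax a (projC C) x = x.
Proof. by move=> cC Cx; rewrite /relax projC_id// -scalerDl subrK scale1r. Qed.

Lemma relaxE a (P : 'rV[R]_n -> 'rV[R]_n) x : relax a P x = x - a *: (x - P x).
Proof. by apply/rowP => i; rewrite !mxE; ring. Qed.

(** With [r = x - p] and [s = c - p] the difference of the two squared norms is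
    [- a (2 - a) |r|^2 + 2 a <r, s>], and the last term is nonpositive by the obtuse angle. *)
Lemma relax_fejer C a x c : closed_convex C -> 0 <= a -> C c ->
  enorm (relax a (projC C) x - c) ^+ 2 <=
  enorm (x - c) ^+ 2 - a * (2 - a) * pdist C x ^+ 2.
Proof.
move=> cC a0 Cc; have := is_proj_obtuse (p := projC C x) (x := x) (y := c).
case: (cC) => _ vC _ /(_ C vC (projC_is_proj x cC) Cc).
rewrite relaxE !enorm_sqr; set p := projC C x.
have -> : x - a *: (x - p) - c = (x - p) - (c - p) - a *: (x - p).
  by apply/rowP => i; rewrite !mxE; ring.
have -> : x - c = (x - p) - (c - p) by apply/rowP => i; rewrite !mxE; ring.
move: (x - p) (c - p) => r s; rewrite !dotvE (dotvC s r).
by move=> h; nra.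
Qed.

End Projection.

(** * Convergence of the iterates *)

Section Convergence.
Context {R : realType} {n : nat}.
Variables (A B : set 'rV[R]_n) (cA : closed_convex A) (cB : closed_convex B).
Variables (a1 a2 : R) (a1_gt1 : 1 < a1) (a1_lt2 : a1 < 2) (a2_gt1 : 1 < a2) (a2_lt2 : a2 < 2).
Variable x : nat -> 'rV[R]_n.
Hypothesis xS : forall k, x k.+1 = relax a2 (projC A) (relax a1 (projC B) (x k)).

Let y k := relax a1 (projC B) (x k).

Lemma gap_fejer c k : A c -> B c ->
  enorm (x k.+1 - c) ^+ 2 <= enorm (x k - c) ^+ 2
    - a1 * (2 - a1) * pdist B (x k) ^+ 2 - a2 * (2 - a2) * pdist A (y k) ^+ 2.
Proof.
have [g1 l1 g2 l2] := And4 a1_gt1 a1_lt2 a2_gt1 a2_lt2.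
move=> Ac Bc; rewrite xS -/(y k).
have a10 : 0 <= a1 by lra.
have a20 : 0 <= a2 by lra.
have := relax_fejer (y k) cA a20 Ac; have := relax_fejer (x k) cB a10 Bc.
rewrite -/(y k); lra.
Qed.

Lemma gap_mono c k m : A c -> B c -> (k <= m)%N -> enorm (x m - c) <= enorm (x k - c).
Proof.
have [g1 l1 g2 l2] := And4 a1_gt1 a1_lt2 a2_gt1 a2_lt2.
move=> Ac Bc; elim: m => [|m IH]; first by rewrite leqn0 => /eqP ->.
rewrite leq_eqVlt => /predU1P[->//|km]; apply: le_trans (IH km).
rewrite -(@ler_pXn2r _ 2)// ?nnegrE ?enorm_ge0//.
apply: le_trans (gap_fejer m Ac Bc) _.
have h1 : 0 <= a1 * (2 - a1) by nra.
have h2 : 0 <= a2 * (2 - a2) by nra.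
have := mulr_ge0 h1 (sqr_ge0 (pdist B (x m))).
have := mulr_ge0 h2 (sqr_ge0 (pdist A (y m))); lra.
Qed.

(** The squared distances to [c] decrease to their infimum, so their decrements become small, and
    the decrements control both projection distances. *)
Lemma gap_step_small c e : A c -> B c -> 0 < e -> exists K, forall k, (K <= k)%N ->
  pdist B (x k) < e /\ pdist A (y k) < e.
Proof.
have [g1 l1 g2 l2] := And4 a1_gt1 a1_lt2 a2_gt1 a2_lt2.
move=> Ac Bc e0.
pose f k := enorm (x k - c) ^+ 2.
have fdec k m : (k <= m)%N -> f m <= f k.
  by move=> km; rewrite lerXn2r// ?nnegrE ?enorm_ge0//; exact: gap_mono.
have h1 : 0 < a1 * (2 - a1) by nra.
have h2 : 0 < a2 * (2 - a2) by nra.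
(* A step at which one of the two distances is at least [e] would lower [f] by at least [w], which
   is impossible once [f] is within [w] of its infimum. *)
pose w := Num.min (a1 * (2 - a1)) (a2 * (2 - a2)) * e ^+ 2.
have w0 : 0 < w by rewrite mulr_gt0 ?exprn_gt0// lt_min h1.
have hinf : has_inf (range f).
  by split; [exists (f 0%N), 0%N|exists 0 => _ [k _ <-]; exact: sqr_ge0].
have [_ [K _ <-] fK] := inf_adherent w0 hinf.
exists K => k Kk.
have := gap_fejer k Ac Bc; rewrite -/(f k.+1) -/(f k) => hk.
have fk : f k <= f K by exact: fdec.
have fi : inf (range f) <= f k.+1 by apply: ge_inf; [exact: hinf.2|exists k.+1].
have wl1 : w <= a1 * (2 - a1) * e ^+ 2 by rewrite ler_pM2r ?exprn_gt0// ge_min lexx.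
have wl2 : w <= a2 * (2 - a2) * e ^+ 2 by rewrite ler_pM2r ?exprn_gt0// ge_min lexx orbT.
have p1 := mulr_ge0 (ltW h1) (sqr_ge0 (pdist B (x k))).
have p2 := mulr_ge0 (ltW h2) (sqr_ge0 (pdist A (y k))).
split; rewrite -(@ltr_pXn2r _ 2)// ?nnegrE ?pdist_ge0// ?ltW//.
  by rewrite -(ltr_pM2l h1); lra.
by rewrite -(ltr_pM2l h2); lra.
Qed.

(** The iterates stay in a compact ball, hence have a cluster point; it lies in both sets because
    the projection distances vanish. Monotonicity with respect to this very point turns clustering
    into convergence. *)
Theorem gap_cvg : A `&` B !=set0 -> exists xs, [/\ A xs, B xs & x @ \oo --> xs].
Proof.
have [g1 l1 g2 l2] := And4 a1_gt1 a1_lt2 a2_gt1 a2_lt2.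
move=> [c [Ac Bc]].
pose D := [set z : 'rV[R]_n | enorm (c - z) <= enorm (x 0%N - c)].
have cD : closed D by exact: closed_enorm_ball.
have kD : compact D by exact: (bounded_enorm_compact (x := c) (r := enorm (x 0%N - c)) cD).
have xD k : D (x k) by rewrite /D /= enormC; exact: gap_mono.
have xnD : (x @ \oo) D by exists 0%N => // k _; exact: xD.
have [xs [_ xsP]] := kD (x @ \oo) _ xnD.
have sub e K : 0 < e -> exists2 k, (K <= k)%N & enorm (x k - xs) < e.
  move=> e0; have [] := xsP (x @` [set k | (K <= k)%N]) [set z | enorm (z - xs) < e].
  - by exists K => // k /= Kk; exists k.
  - by apply/nbhs_enorm; exists e.
  - by move=> _ [[k Kk <-] ke]; exists k.
have Bxs : B xs.
  case: (cB) => clB _ _; apply: closed_enorm clB _ => e e0.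
  have [K Ks] := gap_step_small Ac Bc (divr_gt0 e0 (ltr0n _ 2)).
  have [k Kk ke] := sub (e / 2) K (divr_gt0 e0 (ltr0n _ 2)).
  exists (projC B (x k)); first exact: projC_in.
  have [] := Ks k Kk; rewrite /pdist => h _.
  have := enorm_triangle (x k) (projC B (x k)) xs; rewrite (enormC _ (x k)); lra.
have Axs : A xs.
  case: (cA) => clA _ _; apply: closed_enorm clA _ => e e0.
  (* The budget: [pdist A (y k)] and [|x k - xs|] take [e / 4] each, and
     [|y k - x k| <= 2 * pdist B (x k)] takes [e / 2]. *)
  have e4 : 0 < e / 4 by lra.
  have [K Ks] := gap_step_small Ac Bc e4.
  have [k Kk ke] := sub (e / 4) K e4.
  exists (projC A (y k)); first exact: projC_in.
  have [] := Ks k Kk; rewrite /pdist => h1 h2.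
  have := enorm_triangle (y k) (projC A (y k)) xs; rewrite (enormC _ (y k)).
  have := enorm_triangle (x k) (y k) xs.
  have : enorm (y k - x k) <= 2 * enorm (x k - projC B (x k)).
    rewrite /y relaxE addrAC subrr add0r enormN enormZ ger0_norm; last by lra.
    by rewrite ler_wpM2r ?enorm_ge0//; lra.
  lra.
exists xs; split => //.
move=> U /nbhs_enorm[r r0 rU]; have [k _ kr] := sub r 0%N r0.
exists k => // m /= km; apply: rU; apply: le_lt_trans kr.
exact: gap_mono.
Qed.

End Convergence.

(** * Limits of unit normals *)

Section Normals.
Context {R : realType} {n : nat}.
Implicit Types (A U : set 'rV[R]_n) (u v w x y z h : 'rV[R]_n) (f : 'rV[R]_n -> R).

(** Only points [z] outside [A] are tested, so near an interior point every unit vector qualifies;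
    [outer_limit] below excludes that case. *)
Definition limit_normal A x u := enorm u = 1 /\
  forall e, 0 < e -> exists2 d, 0 < d &
    forall z, ~ A z -> enorm (z - x) < d -> enorm (pnormal A z - u) < e.

(** Differentiability at a zero of [f], with gradient [u]: the case [h = 0] forces [f x = 0]. *)
Definition first_order f x u := forall e, 0 < e -> exists2 d, 0 < d &
  forall h, enorm h < d -> `|f (x + h) - dotv u h| <= e * enorm h.

Lemma diff_first_order d (F : 'rV[R]_n -> 'rV[R]_d) x : differentiable F x -> F x = 0 ->
  forall e, 0 < e -> exists2 r, 0 < r &
    forall h, enorm h < r -> enorm (F (x + h) - 'd F x h) <= e * enorm h.
Proof.
move=> dF Fx e e0.
have e1 : 0 < e / d.+1%:R by rewrite divr_gt0.
have := diff_locallyx dF => /funext/eqaddoP/(_ _ e1) /nbhs_enorm[r r0 rP].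
exists r => // h hr; apply: (le_trans (enorm_le_norm _)).
have := rP h; rewrite subr0 => /(_ hr) /=.
rewrite -[X in `|X| <= _ -> _]/(F (h + x) - (F x + 'd F x h)) Fx add0r (addrC h) => hF.
rewrite mulrC -ler_pdivlMr//; apply: (le_trans hF).
by rewrite [leRHS]mulrAC; apply: ler_wpM2l; [exact: ltW|exact: norm_le_enorm].
Qed.

Lemma affine_continuous (p q : 'rV[R]_n) : continuous (fun s : R => p + s *: q).
Proof.
move=> s; apply: (@cvgD _ _ _ (nbhs s)); first exact: cvg_cst.
by apply: (@cvgZr_tmp _ _ _ (nbhs s)); exact: cvg_id.
Qed.

(** At scale [t] the main term [t * s] outweighs the first-order error at [s = a] and [s = - a], so
    [f] changes sign along [u]. The scale [t] is the same for all tangent vectors [v] of the unit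
    ball. *)
Lemma zero_on_transversal U f x u (a : R) :
  nbhs x U -> (forall y, U y -> {for y, continuous f}) -> enorm u = 1 ->
  first_order f x u -> 0 < a <= 1 ->
  exists2 t, 0 < t & forall v, dotv u v = 0 -> enorm v <= 1 ->
    exists s, [/\ `|s| <= a, U (x + t *: (v + s *: u)) & f (x + t *: (v + s *: u)) = 0].
Proof.
move=> /nbhs_enorm[r r0 rU] cf u1 fo /andP[a0 a1].
(* Displacements have norm at most [2 * t], so this error coefficient gives an error of at most
   [2 / 3 * a * t], below the main term [a * t]. *)
have a3 : 0 < a / 3 by rewrite divr_gt0.
have [d d0 dP] := fo _ a3.
pose m := Num.min r d.
have m0 : 0 < m by rewrite lt_min r0.
have mr : m <= r by rewrite ge_min lexx.
have md : m <= d by rewrite ge_min lexx orbT.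
pose t := m / 3.
have t0 : 0 < t by rewrite divr_gt0.
have tr : 2 * t < r by rewrite /t; lra.
have td : 2 * t < d by rewrite /t; lra.
exists t => // v uv v1.
have hb s : `|s| <= 1 -> enorm (t *: (v + s *: u)) <= 2 * t.
  move=> s1; rewrite enormZ gtr0_norm// mulrC ler_pM2r//.
  by apply: (le_trans (enormD _ _)); rewrite enormZ u1; lra.
pose phi s := f (x + t *: (v + s *: u)).
have phi_app s : `|s| <= 1 -> `|phi s - t * s| <= a / 3 * (2 * t).
  move=> s1; have := dP (t *: (v + s *: u)); rewrite (le_lt_trans (hb _ s1) td) => /(_ isT).
  rewrite !(dotvZr, dotvDr) uv -enorm_sqr u1 expr1n add0r mulr1 => /le_trans; apply.
  by rewrite ler_pM2l// hb.
have aa : - a <= a by lra.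
have cphi : {within `[- a, a], continuous phi}.
  apply: continuous_in_subspaceT => s; rewrite inE /= in_itv /= => sa.
  have s1 : `|s| <= 1 by rewrite ler_norml; lra.
  have phiE : phi = f \o (fun s => (x + t *: v) + s *: (t *: u)).
    by apply/funext => s' /=; congr f; rewrite scalerDr addrA !scalerA mulrC.
  rewrite phiE; apply: continuous_comp; first exact: affine_continuous.
  have <- : x + t *: (v + s *: u) = (x + t *: v) + s *: (t *: u).
    by rewrite scalerDr addrA !scalerA mulrC.
  apply: cf; apply: rU; rewrite addrAC subrr add0r.
  exact: le_lt_trans (hb _ s1) tr.
have na : `|- a| <= 1 by rewrite normrN gtr0_norm.
have pa : `|a| <= 1 by rewrite gtr0_norm.
have at0 : 0 < a * t by rewrite mulr_gt0.
have := phi_app _ na; have := phi_app _ pa; rewrite !ler_norml => h1 h2.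
have p1 : 0 <= phi a by nra.
have p2 : phi (- a) <= 0 by nra.
have [|s] := IVT aa cphi (v := 0).
  by rewrite ge_min p2 le_max p1 !orbT.
rewrite in_itv /= => sa phis.
have s1 : `|s| <= 1 by rewrite ler_norml; lra.
exists s; split => //; first by rewrite ler_norml; lra.
apply: rU; rewrite addrAC subrr add0r; exact: le_lt_trans (hb _ s1) tr.
Qed.

(** Let [T] be the part of [N] orthogonal to [u] and [b = <N, u>]. A zero of [f] near [x + t T] lies
    in [A], and [N] almost supports [A] at [x], so [|T|^2 = 1 - b^2] is small. The interior point
    [x + v], on the negative side of [u], then excludes [b <= 0]. *)
Lemma limit_normal_scalar A U f x u v : closed_convex A -> A x -> A° (x + v) ->
  dotv u v < 0 -> enorm u = 1 -> first_order f x u -> nbhs x U ->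
  (forall y, U y -> {for y, continuous f}) -> (forall y, U y -> f y = 0 -> A y) ->
  limit_normal A x u.
Proof.
move=> cA Ax /interior_enorm[r0 r00 r0A] uv u1 fo nU cf fA; split => // e e0.
pose r := r0 / 2.
have r_gt0 : 0 < r by rewrite divr_gt0.
have rA y : enorm (y - (x + v)) <= r -> A y.
  by move=> yr; apply: r0A; rewrite /r in yr; lra.
have V0 := dotvv_ge0 v; set V := dotv v v in V0.
(* The first bound yields [|N - u|^2 = 2 - 2 b <= 4 a < e^2]; the second makes
   [|T|^2 |v|^2 <= 2 a V] smaller than [r^2 / 4], which is what [b <= 0] would contradict. *)
pose a := Num.min 1 (Num.min (e ^+ 2 / 8) (r ^+ 2 / (16 * (1 + V)))).
have a1 : a <= 1 by rewrite ge_min lexx.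
have ae : a <= e ^+ 2 / 8 by rewrite /a minCA ge_min lexx.
have aV : a * (16 * (1 + V)) <= r ^+ 2.
  by rewrite -ler_pdivlMr; [rewrite /a minA ge_min lexx orbT|lra].
have a0 : 0 < a.
  by rewrite !lt_min ltr01 !divr_gt0 ?exprn_gt0//; lra.
have a01 : 0 < a <= 1 by rewrite a0.
have [t t0 tP] := zero_on_transversal nU cf u1 fo a01.
have at0 : 0 < a * t by rewrite mulr_gt0.
exists (Num.min (a * t) (r / 2) / 2).
  by rewrite divr_gt0// lt_min at0 divr_gt0.
move=> z nAz; set m := Num.min _ _ => zm.
have m1 : m <= a * t by rewrite ge_min lexx.
have m2 : m <= r / 2 by rewrite ge_min lexx orbT.
set N := pnormal A z; set p := projC A z.
have N1 : enorm N = 1 by exact: enorm_pnormal.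
have NN : dotv N N = 1 by exact: dotv_pnormal.
have uu : dotv u u = 1 by rewrite -enorm_sqr u1 expr1n.
have px : enorm (p - x) <= m by have := projC_dist z cA Ax; rewrite -/p; lra.
have Np : dotv N (p - x) <= m.
  by apply: (le_trans (dotv_le _ _)); rewrite N1 mul1r.
have Nle y : A y -> dotv N (y - x) <= m.
  move=> Ay; have := pnormal_le0 cA nAz Ay; rewrite -/N -/p.
  have -> : y - p = (y - x) - (p - x) by apply/rowP => i; rewrite !mxE; ring.
  by rewrite dotvBr; lra.
set b := dotv N u.
have b1 : `|b| <= 1 by have := dotv_abs N u; rewrite N1 u1 mulr1.
have bb : b ^+ 2 <= 1 by rewrite -real_normK ?num_real// -(expr1n _ 2) lerXn2r ?nnegrE.
pose T := N - b *: u.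
have uT : dotv u T = 0 by rewrite dotvBr dotvZr uu (dotvC u) -/b; ring.
have NT : dotv N T = 1 - b ^+ 2 by rewrite dotvBr dotvZr NN -/b; ring.
have TT : dotv T T = 1 - b ^+ 2.
  by rewrite {1}/T dotvBl dotvZl uT NT; ring.
have T1 : enorm T <= 1 by apply: enorm_le => //; rewrite TT; have := sqr_ge0 b; lra.
have [s [sa Us fs]] := tP T uT T1.
have := Nle _ (fA _ Us fs); rewrite addrAC subrr add0r dotvZr dotvDr dotvZr NT -/b => h1.
have sb : `|s * b| <= a by rewrite normrM -[leRHS]mulr1 ler_pM.
have h2 : t * (1 - b ^+ 2) <= t * (2 * a).
  by move: sb; rewrite ler_norml => /andP[h2 h3]; nra.
have {}h2 : 1 - b ^+ 2 <= 2 * a by rewrite -(ler_pM2l t0).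
(* Pushing the interior point by [r] along [N] keeps it in [A], so [<N, v>] is at most [m - r],
   hence definitely negative. *)
have rN : A (x + v + r *: N).
  by apply: rA; rewrite addrAC subrr add0r enormZ N1 mulr1 gtr0_norm.
have := Nle _ rN.
have -> : x + v + r *: N - x = v + r *: N by apply/rowP => i; rewrite !mxE; ring.
rewrite dotvDr dotvZr NN mulr1 => h3.
have h4 : dotv N v <= - (r / 2) by lra.
have b0 : 0 < b.
  rewrite ltNge; apply/negP => b0.
  have h5 : dotv T v <= - (r / 2).
    have h5 : 0 <= b * dotv u v by nra.
    by rewrite dotvBl dotvZl; lra.
  have h6 : dotv T v ^+ 2 <= (1 - b ^+ 2) * V.
    rewrite -TT /V -!enorm_sqr -exprMn -real_normK ?num_real//.
    by rewrite lerXn2r ?nnegrE ?mulr_ge0 ?enorm_ge0// dotv_abs.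
  have h7 : (1 - b ^+ 2) * V <= 2 * a * V by rewrite ler_wpM2r.
  have h8 : r ^+ 2 / 4 <= dotv T v ^+ 2 by nra.
  have h9 : 0 < r ^+ 2 by exact: exprn_gt0.
  by move: h6 h7 h8 h9 aV a0; clear; nra.
rewrite -(@ltr_pXn2r _ 2)// ?nnegrE ?enorm_ge0// ?ltW//.
rewrite enorm_sqr -[u]scale1r dotv_subZ NN uu -/b.
have : 0 < e ^+ 2 by rewrite exprn_gt0.
move: b1; rewrite ler_norml => /andP[_ b1]; nra.
Qed.

End Normals.

(** * Boundary charts of convex sets *)

Section Charts.
Context {R : realType} {n : nat}.
Implicit Types (A U : set 'rV[R]_n) (u v w x y z h p q : 'rV[R]_n).

(** The homothety with centre [q] and ratio [t] carries a ball of [A] around [p] to a ball of [A]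
    around the combination. *)
Lemma interior_segment A p q (t : R) : convex_set A -> A° p -> A q -> 0 < t <= 1 ->
  A° (t *: p + (1 - t) *: q).
Proof.
move=> vA /interior_enorm[r r0 rA] Aq /andP[t0 t1]; apply/interior_enorm.
exists (t * r); first by rewrite mulr_gt0.
move=> y yr; have tn0 : t != 0 by rewrite gt_eqF.
pose z := p + t^-1 *: (y - (t *: p + (1 - t) *: q)).
have -> : y = (1 - (1 - t)) *: z + (1 - t) *: q.
  rewrite subKr /z scalerDr scalerA divff// scale1r.
  by apply/rowP => i; rewrite !mxE; ring.
apply: vA => //; last by lra.
apply: rA; rewrite /z addrAC subrr add0r enormZ gtr0_norm ?invr_gt0//.
by rewrite mulrC ltr_pdivrMr// mulrC.
Qed.

(** Off the boundary, [A] coincides with its interior; the parameters whose point lies in [A] are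
    therefore both open and closed in [[0, 1]], and connectedness applies. *)
Lemma segment_avoids_bd A p q : closed A -> A p ->
  (forall t : R, 0 <= t <= 1 -> ~ bd A (p + t *: (q - p))) -> A q.
Proof.
move=> cA Ap nbd; pose g (t : R) := p + t *: (q - p).
pose B := [set t : R | `[0, 1]%classic t /\ A (g t)].
have cg : continuous g by exact: affine_continuous.
have BE : B = `[0, 1]%classic.
  apply: (@segment_connected R 0 1).
  - by exists 0; split; rewrite /= ?in_itv /= ?lexx ?ler01// /g scale0r addr0.
  - exists (g @^-1` A°).
      by apply: open_comp; [move=> t _; exact: cg|exact: open_interior].
    apply/seteqP; split=> [t [t01 At]|t [t01 At]]; split => //.
      apply: contrapT => nint; apply: (nbd t); first by move: t01; rewrite /= in_itv.
      by split => //; exact: subset_closure.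
    exact: interior_subset At.
  - exists (g @^-1` A) => //.
    by apply: (@closed_comp _ _ g) => // t _; exact: cg.
have : B 1 by rewrite BE /= in_itv /= ler01 lexx.
by move=> [_]; rewrite /g scale1r addrC subrK.
Qed.

(* If 'd F x v and 'd F x w were independent, x would be an isolated point of bd A in the plane
   x + <v, w>; the interior point x + t v could then be joined to x - t v off bd A, so that
   x - t v would lie in A and x in the interior of A. *)
Lemma chart_rank_one A U d (F : 'rV[R]_n -> 'rV[R]_d) x v :
  closed_convex A -> bd A x -> nbhs x U -> (forall y, U y -> (bd A y <-> F y = 0)) ->
  differentiable F x -> A° (x + v) -> 'd F x v != 0 ->
  forall w, exists s : R, 'd F x w = s *: 'd F x v.
Proof.
move=> [cA vA _] bx /nbhs_enorm[r r0 rU] FU dF Av Lv w0.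
apply: contrapT => nex.
have Ax : A x by case: bx => /cA.
have Fx : F x = 0 by apply/FU => //; apply: rU; rewrite subrr enorm0.
set L := 'd F x in Lv nex *.
pose P := dotv (L v) (L v).
have P0 : 0 < P by rewrite /P -enorm_sqr exprn_gt0// enorm_gt0.
pose s0 := dotv (L w0) (L v) / P.
(* Gram-Schmidt in the image: [L w] becomes orthogonal to [L v]. *)
pose w := w0 - s0 *: v.
have LwE : L w = L w0 - s0 *: L v by rewrite /w linearB linearZ.
have Lw : L w != 0.
  by apply/negP => /eqP Lw0; apply: nex; exists s0; apply/eqP; rewrite -subr_eq0 -LwE Lw0.
have Lvw : dotv (L v) (L w) = 0.
  by rewrite LwE dotvBr dotvZr -/P /s0 divfK ?gt_eqF// (dotvC (L v)) subrr.
pose Q := dotv (L w) (L w).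
have Q0 : 0 < Q by rewrite /Q -enorm_sqr exprn_gt0// enorm_gt0.
(* On the diamond [|a| + |b| = 1] one has [a^2 + b^2 >= 1 / 2], so [m] bounds [|L (a v + b w)|^2]
   from below. *)
pose m := Num.min P Q / 2.
have m0 : 0 < m by rewrite divr_gt0// lt_min P0.
have mP : 2 * m <= P.
  have : Num.min P Q <= P by rewrite ge_min lexx.
  by rewrite /m; lra.
have mQ : 2 * m <= Q.
  have : Num.min P Q <= Q by rewrite ge_min lexx orbT.
  by rewrite /m; lra.
have Lab (a b : R) : `|a| + `|b| = 1 -> Num.sqrt m <= enorm (L (a *: v + b *: w)).
  move=> ab; rewrite /enorm ler_wsqrtr// linearD !linearZ !dotvE (dotvC (L w)) Lvw -/P -/Q.
  have ab2 : 1 / 2 <= a ^+ 2 + b ^+ 2.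
    rewrite -(real_normK (num_real a)) -(real_normK (num_real b)).
    by move: `|a| `|b| ab => a' b' ab; have := sqr_ge0 (a' - b'); nra.
  have ha : 0 <= a ^+ 2 * (P - 2 * m) by rewrite mulr_ge0 ?sqr_ge0// subr_ge0.
  have hb : 0 <= b ^+ 2 * (Q - 2 * m) by rewrite mulr_ge0 ?sqr_ge0// subr_ge0.
  have hm : 0 <= m * (a ^+ 2 + b ^+ 2 - 1 / 2) by rewrite mulr_ge0 ?subr_ge0// ltW.
  by move: ha hb hm; clear; nra.
pose K := enorm v + enorm w + 1.
have K0 : 0 < K by have := enorm_ge0 v; have := enorm_ge0 w; rewrite /K; lra.
have hK (a b : R) : `|a| + `|b| = 1 -> enorm (a *: v + b *: w) < K.
  move=> ab; apply: le_lt_trans (enormD _ _) _; rewrite !enormZ /K.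
  have := normr_ge0 a; have := normr_ge0 b; have := enorm_ge0 v; have := enorm_ge0 w; nra.
have sm0 : 0 < Num.sqrt m by rewrite sqrtr_gt0.
have o0 : 0 < Num.sqrt m / (2 * K) by rewrite divr_gt0// mulr_gt0.
have [e e0 eP] := diff_first_order dF Fx o0.
pose t := Num.min 1 (Num.min r e / K).
have t0 : 0 < t by rewrite lt_min ltr01 divr_gt0// lt_min r0.
have t1 : t <= 1 by rewrite ge_min lexx.
have tK : t * K <= Num.min r e by rewrite -ler_pdivlMr// ge_min lexx orbT.
have hsmall (a b : R) : `|a| + `|b| = 1 -> enorm (t *: (a *: v + b *: w)) < Num.min r e.
  move=> ab; apply: lt_le_trans tK; rewrite enormZ gtr0_norm// ltr_pM2l//.
  exact: hK.
have avoid (a b : R) : `|a| + `|b| = 1 -> ~ bd A (x + t *: (a *: v + b *: w)).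
  move=> ab; have := hsmall _ _ ab; rewrite lt_min => /andP[hr he].
  have Uh : U (x + t *: (a *: v + b *: w)) by apply: rU; rewrite addrAC subrr add0r.
  move=> /(FU _ Uh).1 F0.
  have := eP _ he; rewrite F0 sub0r enormN linearZ !enormZ gtr0_norm//.
  have := Lab _ _ ab; have := hK _ _ ab; set E := enorm (a *: v + b *: w).
  rewrite -/L mulrCA ler_pM2l// => EK h1 h2.
  have : Num.sqrt m / (2 * K) * E <= Num.sqrt m / 2.
    rewrite invfM mulrA -mulrA ler_piMr// ?divr_ge0//; first exact: ltW.
    by rewrite mulrC ler_pdivrMr// mul1r ltW.
  lra.
(* The path from [x + t v] through [x + t w] to [x - t v] runs along two edges of the diamond, on
   which [F] has no zero. *)
have A1 : A (x + t *: v).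
  have := vA x (x + v) t Ax (interior_subset Av); rewrite ltW// t1 => /(_ isT).
  by congr A; apply/rowP => i; rewrite !mxE; ring.
have A2 : A (x + t *: w).
  apply: segment_avoids_bd cA A1 _ => s s01.
  have := avoid (1 - s) s; rewrite !ger0_norm; [|lra|lra].
  rewrite subrK => /(_ erefl); congr (~ bd A _).
  by apply/rowP => i; rewrite !mxE; ring.
have A3 : A (x - t *: v).
  apply: segment_avoids_bd cA A2 _ => s s01.
  have := avoid (- s) (1 - s); rewrite normrN !ger0_norm; [|lra|lra].
  rewrite addrC subrK => /(_ erefl); congr (~ bd A _).
  by apply/rowP => i; rewrite !mxE; ring.
case: bx => _; apply.
have t10 : 0 < 1 + t by lra.
have -> : x = (t / (1 + t)) *: (x + v) + (1 - t / (1 + t)) *: (x - t *: v).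
  by apply/rowP => i; rewrite !mxE; field; rewrite gt_eqF.
apply: interior_segment => //.
by rewrite divr_gt0//= ler_pdivrMr//; lra.
Qed.

(** Start from an interior point [a]; if the derivative kills [a - x], a small perturbation inside
    the interior ball repairs this as soon as the derivative is nonzero. *)
Lemma exists_transversal A U d (F : 'rV[R]_n -> 'rV[R]_d) x :
  closed_convex A -> solid A -> bd A x -> nbhs x U ->
  (forall y, U y -> (bd A y <-> F y = 0)) ->
  (forall w : 'rV[R]_d, exists v, 'd F x v = w) ->
  exists v, A° (x + v) /\ 'd F x v != 0.
Proof.
move=> [cA vA _] [a Aa] bx nU FU sF.
have Ax : A x by case: bx => /cA.
have [L0|] := eqVneq ('d F x (a - x)) 0; last by exists (a - x); rewrite addrC subrK.
(* A zero surjective derivative makes the target trivial, so [F] vanishes identically and a whole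
   neighbourhood of [x] lies in [bd A]; but interior points of [A] occur arbitrarily near [x]. *)
have [w Lw] : exists w, 'd F x w != 0.
  apply: contrapT => nw.
  have F0 y : F y = 0.
    have [v <-] := sF (F y); apply/eqP/negPn/negP => vn.
    by apply: nw; exists v.
  have [r r0 rU] := (nbhs_enorm _ _).1 nU.
  pose K := 1 + enorm (a - x).
  have K0 : 0 < K by have := enorm_ge0 (a - x); rewrite /K; lra.
  pose t := Num.min 1 (r / K).
  have t0 : 0 < t by rewrite lt_min ltr01 divr_gt0.
  have t1 : t <= 1 by rewrite ge_min lexx.
  have tK : t * K <= r by rewrite -ler_pdivlMr// ge_min lexx orbT.
  have At : A° (t *: a + (1 - t) *: x) by apply: interior_segment => //; rewrite t0.
  have : bd A (t *: a + (1 - t) *: x).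
    apply/FU => //; apply: rU.
    have -> : t *: a + (1 - t) *: x - x = t *: (a - x).
      by apply/rowP => i; rewrite !mxE; ring.
    by rewrite enormZ gtr0_norm//; move: tK; rewrite /K; nra.
  by move=> [_].
have [r r0 rA] := (interior_enorm _ _).1 Aa.
have w0 : w != 0 by apply: contraNneq Lw => ->; rewrite linear0.
have ew := enorm_gt0 w0.
pose t := r / 2 / enorm w.
have t0 : 0 < t by rewrite !divr_gt0.
exists (a - x + t *: w); split.
  apply/interior_enorm; exists (r / 2); first by rewrite divr_gt0.
  move=> y yr; apply: rA.
  have -> : y - a = (y - (x + (a - x + t *: w))) + t *: w by apply/rowP => i; rewrite !mxE; ring.
  apply: le_lt_trans (enormD _ _) _.
  by rewrite enormZ gtr0_norm// {2}/t divfK ?gt_eqF//; lra.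
by rewrite linearD linearZ L0 add0r scaler_eq0 negb_or Lw gt_eqF.
Qed.

Lemma scalar_chart d (F : 'rV[R]_n -> 'rV[R]_d) x v :
  differentiable F x -> F x = 0 -> (forall w : 'rV[R]_d, exists v, 'd F x v = w) -> 'd F x v != 0 ->
  (forall w, exists s : R, 'd F x w = s *: 'd F x v) ->
  exists (c : R) (j : 'I_d) u,
    [/\ enorm u = 1, dotv u v < 0, tker F x = [set w | dotv u w = 0],
        forall y, c * F y 0 j = 0 -> F y = 0 & first_order (fun y => c * F y 0 j) x u].
Proof.
move=> dF Fx sF Lv rk; set L := 'd F x in Lv rk sF *.
have /rV0Pn[j Lvj] := Lv.
have dj i : i = j.
  apply/eqP/negPn/negP => ij.
  have [w Lw] := sF (delta_mx 0 i); have [s Ls] := rk w.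
  have /rowP/(_ j) := Ls; rewrite Lw !mxE eqxx (negbTE (_ : j != i)) 1?eq_sym// => /esym/eqP.
  rewrite mulf_eq0 (negbTE Lvj) orbF => /eqP s0.
  move: Ls; rewrite Lw s0 scale0r => /rowP/(_ i); rewrite !mxE !eqxx => /eqP.
  by rewrite oner_eq0.
pose g : 'rV[R]_n := \row_i L (delta_mx 0 i) 0 j.
have gE w : L w 0 j = dotv g w.
  rewrite [in LHS](row_sum_delta w) linear_sum summxE; apply: eq_bigr => i _.
  by rewrite linearZ !mxE mulrC.
have g0 : g != 0.
  by apply: contraNneq Lvj => g0; rewrite gE g0 -(scale0r 0) dotvZl mul0r.
have eg := enorm_gt0 g0.
(* The sign orients [u] away from [v], the direction of the interior in the main application. *)
pose c := - Num.sg (dotv g v) / enorm g.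
have gv : dotv g v != 0 by rewrite -gE.
have c0 : c != 0 by rewrite mulf_neq0 ?oppr_eq0 ?sgr_eq0 ?invr_eq0// gt_eqF.
exists c, j, (c *: g); split.
- by rewrite enormZ normrM normrN normr_sg gv mul1r ger0_norm ?invr_ge0 ?enorm_ge0// mulVf// gt_eqF.
- rewrite dotvZl /c !mulNr mulrAC -normrEsg oppr_lt0 divr_gt0//.
  by rewrite normr_gt0.
- apply/seteqP; split=> w; rewrite /tker /= dotvZl -gE -/L.
    by move=> ->; rewrite mxE mulr0.
  move=> /eqP; rewrite mulf_eq0 (negbTE c0) => /eqP h.
  by apply/rowP => i; rewrite (dj i) h mxE.
- move=> y /eqP; rewrite mulf_eq0 (negbTE c0) => /eqP h.
  by apply/rowP => i; rewrite (dj i) h mxE.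
move=> e e0; have ec : 0 < e / `|c| by rewrite divr_gt0// normr_gt0.
have [r r0 rP] := diff_first_order dF Fx ec; exists r => // h /rP.
rewrite -/L dotvZl -gE -mulrBr => hF; rewrite normrM mulrC -ler_pdivlMr ?normr_gt0//.
by have := le_trans (coord_le_enorm _ j) hF; rewrite !mxE mulrAC.
Qed.

Lemma scaled_coord_continuous d (F : 'rV[R]_n -> 'rV[R]_d) (c : R) j y :
  differentiable F y -> {for y, continuous (fun z => c * F z 0 j)}.
Proof.
move=> dF; apply: (@cvgM _ _ (nbhs y) _ (fun _ => c) (fun z => F z 0 j)); first exact: cvg_cst.
apply: (@cvg_comp _ _ _ F (fun M : 'rV[R]_d => M 0 j) (nbhs y) (nbhs (F y))).
  exact: differentiable_continuous dF.
exact: coord_continuous.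
Qed.

Lemma chart_limit_normal A x k d U (F : 'rV[R]_n -> 'rV[R]_d) :
  closed_convex A -> solid A -> bd A x -> is_chart k.+1 (bd A) x U F ->
  exists u, tker F x = [set v | dotv u v = 0] /\ limit_normal A x u.
Proof.
move=> cA sA bx [oU Ux [dF _] sF FU].
have nU : nbhs x U by exact: open_nbhs_nbhs.
have [v [Av Lv]] := exists_transversal cA sA bx nU FU (sF x Ux).
have rk := chart_rank_one cA bx nU FU (dF x Ux) Av Lv.
have Fx : F x = 0 by exact/FU.
have [c [j [u [u1 uv kerF F0 fo]]]] := scalar_chart (dF x Ux) Fx (sF x Ux) Lv rk.
exists u; split => //; have clA : closed A by case: cA.
apply: (limit_normal_scalar cA _ Av uv u1 fo nU).
- by case: bx => /clA.
- by move=> y /dF; exact: scaled_coord_continuous.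
- by move=> y Uy /F0/(FU y Uy)[/clA].
Qed.

End Charts.

(** * The coupled recursion of the distances *)

Section Recursion.
Context {R : realType}.
Implicit Types (al be : nat -> R) (mu tau delta e : R).

(** With negative discriminant, complete the square. Otherwise the larger root lies below [mu], and
    both linear factors are at least its distance to [mu]. *)
Lemma quadratic_bounded_below tau delta mu :
  (forall l : R, mu <= l -> l ^+ 2 - tau * l + delta != 0) ->
  exists2 e, 0 < e & forall l : R, mu <= l -> e <= l ^+ 2 - tau * l + delta.
Proof.
move=> q0; have [D0|D0] := ltP (tau ^+ 2 - 4 * delta) 0.
  exists (- (tau ^+ 2 - 4 * delta) / 4); first by lra.
  by move=> l _; have := sqr_ge0 (l - tau / 2); nra.
pose s := Num.sqrt (tau ^+ 2 - 4 * delta).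
have s0 : 0 <= s by exact: sqrtr_ge0.
have ss : s ^+ 2 = tau ^+ 2 - 4 * delta by exact: sqr_sqrtr.
have rmu : (tau + s) / 2 < mu.
  rewrite ltNge; apply/negP => /q0/eqP; apply.
  have -> : ((tau + s) / 2) ^+ 2 - tau * ((tau + s) / 2) + delta =
    (s ^+ 2 - (tau ^+ 2 - 4 * delta)) / 4 by field.
  by rewrite ss subrr mul0r.
exists ((mu - (tau + s) / 2) ^+ 2); first by rewrite exprn_gt0// subr_gt0.
move=> l lmu.
have -> : l ^+ 2 - tau * l + delta = (l - (tau + s) / 2) * (l - (tau - s) / 2).
  have -> : (l - (tau + s) / 2) * (l - (tau - s) / 2) = l ^+ 2 - tau * l + (tau ^+ 2 - s ^+ 2) / 4 by field.
  by rewrite ss; field.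
by rewrite expr2; apply: ler_pM; lra.
Qed.

(* The ratios r_k of consecutive terms satisfy r_(k+1) <= tau + o(1) - delta / r_k; as long as
   r_k >= mu this forces a definite decrease, because l^2 - tau l + delta stays positive there. *)
Lemma ratio_eventually_le al tau delta mu : (forall k, 0 < al k) -> 0 < delta -> 0 < mu ->
  (forall e, 0 < e -> exists K, forall k, (K <= k)%N ->
     al k.+2 <= (tau + e) * al k.+1 - delta * al k) ->
  (forall l : R, mu <= l -> l ^+ 2 - tau * l + delta != 0) ->
  exists K, forall k, (K <= k)%N -> al k.+1 <= mu * al k.
Proof.
move=> al0 d0 mu0 hrec /quadratic_bounded_below[eta eta0 q0].
have [T T0 tauT] : exists2 T, 0 < T & tau + 1 <= T.
  by exists (`|tau| + 1); [rewrite ltr_wpDl|rewrite lerD2r ler_norm].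
(* The bound [eta / (2 * T)] preserves half of the drop [eta / T] while the ratio is at least [mu];
   the bound [eta / mu] keeps a ratio that is below [mu] from leaving again. *)
pose e := Num.min 1 (Num.min (eta / (2 * T)) (eta / mu)).
have e1 : e <= 1 by rewrite ge_min lexx.
have eT : e <= eta / (2 * T) by rewrite /e minCA ge_min lexx.
have emu : e <= eta / mu by rewrite /e minA ge_min lexx orbT.
have e0 : 0 < e by rewrite !lt_min ltr01 !divr_gt0// mulr_gt0.
have [K hK] := hrec _ e0.
have [r rdef] : exists r : nat -> R, forall k, r k = al k.+1 / al k by eexists.
have r0 k : 0 < r k by rewrite rdef divr_gt0.
have rE k : (K <= k)%N -> r k.+1 <= tau + e - delta / r k.
  move=> /hK h; rewrite [leLHS]rdef ler_pdivrMr// mulrBl; apply: (le_trans h).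
  suff -> : delta / r k * al k.+1 = delta * al k by [].
  by rewrite rdef; field; rewrite !gt_eqF.
have rT k : (K <= k)%N -> r k.+1 <= T.
  move=> Kk; apply: (le_trans (rE k Kk)).
  have : 0 < delta / r k by rewrite divr_gt0.
  by lra.
have rdec k : (K < k)%N -> mu <= r k -> r k.+1 <= r k - eta / (2 * T).
  case: k => // k Kk rmu; apply: (le_trans (rE _ (ltnW Kk))).
  have rk := rT _ Kk; have := q0 _ rmu; have rk0 := r0 k.+1.
  set l := r k.+1 in rk rk0 rmu * => ql.
  have : eta / T <= l - tau + delta / l.
    have -> : l - tau + delta / l = (l ^+ 2 - tau * l + delta) / l.
      by field; rewrite gt_eqF.
    apply: ler_pM => //; [exact: ltW|by rewrite invr_ge0 ltW|by rewrite lef_pV2].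
  have -> : eta / T = eta / (2 * T) + eta / (2 * T).
    by field; rewrite gt_eqF.
  lra.
have rstay k : (K < k)%N -> r k <= mu -> r k.+1 <= mu.
  move=> Kk rmu; apply: (le_trans (rE _ (ltnW Kk))).
  have : delta / mu <= delta / r k by rewrite ler_pM2l// lef_pV2 ?posrE.
  have : eta / mu <= mu - tau + delta / mu.
    have -> : mu - tau + delta / mu = (mu ^+ 2 - tau * mu + delta) / mu.
      by field; rewrite gt_eqF.
    by rewrite ler_pM2r ?invr_gt0//; exact: q0.
  lra.
have [k0 Kk0 rk0] : exists2 k, (K < k)%N & r k <= mu.
  apply: contrapT => nex.
  have rgt k : (K < k)%N -> mu < r k.
    by move=> Kk; rewrite ltNge; apply/negP => h; apply: nex; exists k.
  have c0 : 0 < eta / (2 * T) by rewrite divr_gt0// mulr_gt0.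
  move: (eta / (2 * T)) c0 rdec => c c0 rdec.
  have rj j : r (K.+1 + j)%N <= r K.+1 - j%:R * c.
    elim: j => [|j IH]; first by rewrite addn0 mul0r subr0.
    have Kj : (K < K.+1 + j)%N by rewrite leq_addr.
    have := rdec _ Kj (ltW (rgt _ Kj)); rewrite addnS -natr1 mulrDl mul1r; lra.
  have rc0 : 0 <= r K.+1 / c by rewrite divr_ge0// ltW.
  have := archi_boundP rc0; set j := Num.Def.archi_bound _ => hj.
  have := rj j; have := r0 (K.+1 + j)%N.
  by move: hj; rewrite ltr_pdivrMr//; lra.
exists k0 => k; elim: k => [|k IH] k0k.
  by move: Kk0; rewrite leqn0 in k0k; rewrite (eqP k0k).
rewrite -ler_pdivrMr// -rdef.
move: k0k; rewrite leq_eqVlt => /predU1P[<-//|k0k].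
apply: rstay; first exact: leq_trans Kk0 _.
by rewrite rdef ler_pdivrMr//; exact: IH.
Qed.

(** Eliminating [be] leaves a second-order inequality for [al] with characteristic polynomial [l^2 -
    tau l + delta = (l + b1) (l + b2) - a1 a2 kap^2 l], to which the ratio lemma applies. *)
Lemma coupled_recursion_decay al be (a1 a2 kap : R) mu : 1 < a1 -> 1 < a2 ->
  (forall k, 0 < al k) -> (forall k, 0 < be k) -> 0 < mu ->
  (forall e, 0 < e -> exists K, forall k, (K <= k)%N ->
     `|al k.+1 - (a1 * kap * be k.+1 - (a2 - 1) * al k)| <= e * (al k + be k.+1) /\
     `|be k.+1 - (a2 * kap * al k - (a1 - 1) * be k)| <= e * (al k + be k)) ->
  (forall l : R, 0 < kap -> mu <= l -> (l + (a1 - 1)) * (l + (a2 - 1)) != a1 * a2 * kap ^+ 2 * l) ->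
  exists C K, [/\ 0 < C, forall k, (K <= k)%N -> al k.+1 <= mu * al k &
    forall k, (K <= k)%N -> be k <= C * al k].
Proof.
move=> g1 g2 al0 be0 mu0 hrec hroot.
set b1 := a1 - 1 in hrec hroot; set b2 := a2 - 1 in hrec hroot.
have b10 : 0 < b1 by rewrite subr_gt0.
have b20 : 0 < b2 by rewrite subr_gt0.
clearbody b1 b2.
have [e1 [e10 e11 e1b1 e1b2]] : exists e : R, [/\ 0 < e, 3 * e <= 1, 3 * e <= b1 & 3 * e <= b2].
  have m0 : 0 < Num.min 1 (Num.min b1 b2) by rewrite !lt_min ltr01 b10.
  have m1 : Num.min 1 (Num.min b1 b2) <= 1 by rewrite ge_min lexx.
  have mb1 : Num.min 1 (Num.min b1 b2) <= b1 by rewrite minCA ge_min lexx.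
  have mb2 : Num.min 1 (Num.min b1 b2) <= b2 by rewrite minA ge_min lexx orbT.
  by exists (Num.min 1 (Num.min b1 b2) / 3); split; lra.
have [K1 h1] := hrec _ e10.
(* For kap <= 0 the two recursions force a negative distance. *)
have kap0 : 0 < kap.
  rewrite ltNge; apply/negP => kap0.
  have [] := h1 K1 (leqnn _); rewrite !ler_norml => /andP[_ p1] /andP[_ p2].
  have q1 := al0 K1; have q2 := be0 K1; have q3 := al0 K1.+1; have q4 := be0 K1.+1.
  have p3 : a1 * kap * be K1.+1 <= 0 by rewrite pmulr_lle0//; nra.
  have p4 : a2 * kap * al K1 <= 0 by rewrite pmulr_lle0//; nra.
  have p5 : be K1.+1 <= e1 * al K1.
    have p6 : 0 <= be K1 * (b1 - 3 * e1) by rewrite mulr_ge0 ?subr_ge0// ltW.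
    have p7 : 0 < be K1 * e1 by rewrite mulr_gt0.
    by clear -p2 p4 p6 p7; lra.
  have p6 : e1 * be K1.+1 <= e1 * al K1.
    by rewrite ler_pM2l//; apply: (le_trans p5); rewrite ger_pMl//; lra.
  have p7 : 0 <= al K1 * (b2 - 3 * e1) by rewrite mulr_ge0 ?subr_ge0// ltW.
  have p8 : 0 < al K1 * e1 by rewrite mulr_gt0.
  by clear -p1 p3 p6 p7 p8 q3; lra.
have A1 : 0 < a1 * kap by rewrite mulr_gt0//; lra.
have A2 : 0 < a2 * kap by rewrite mulr_gt0//; lra.
(* Positivity of the next distance in each recursion gives [al k <= C1 * be k.+1] and
   [be k <= C2 * al k], so every error term becomes a multiple of [al k.+1]. *)
pose C1 := (a1 * kap + 1) / e1; pose C2 := (a2 * kap + 1) / e1.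
have C10 : 0 < C1 by rewrite divr_gt0//; lra.
have C20 : 0 < C2 by rewrite divr_gt0//; lra.
have alC k : (K1 <= k)%N -> al k <= C1 * be k.+1.
  move=> /h1[]; rewrite ler_norml => /andP[_ p] _.
  have := al0 k; have := al0 k.+1; have := be0 k.+1 => q1 q2 q3.
  rewrite /C1 mulrAC ler_pdivlMr//.
  have p4 : 0 <= al k * (b2 - 3 * e1) by rewrite mulr_ge0 ?subr_ge0// ltW.
  have p5 : 0 <= be k.+1 * (1 - 3 * e1) by rewrite mulr_ge0 ?subr_ge0// ltW.
  have p6 : 0 < al k * e1 by rewrite mulr_gt0.
  have p7 : 0 < be k.+1 * e1 by rewrite mulr_gt0.
  by clear -p q2 p4 p5 p6 p7; lra.
have beC k : (K1 <= k)%N -> be k <= C2 * al k.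
  move=> /h1[_]; rewrite ler_norml => /andP[_ p].
  have := be0 k; have := be0 k.+1; have := al0 k => q1 q2 q3.
  rewrite /C2 mulrAC ler_pdivlMr//.
  have p4 : 0 <= be k * (b1 - 3 * e1) by rewrite mulr_ge0 ?subr_ge0// ltW.
  have p5 : 0 <= al k * (1 - 3 * e1) by rewrite mulr_ge0 ?subr_ge0// ltW.
  have p6 : 0 < be k * e1 by rewrite mulr_gt0.
  have p7 : 0 < al k * e1 by rewrite mulr_gt0.
  by clear -p q2 p4 p5 p6 p7; lra.
pose tau := a1 * a2 * kap ^+ 2 - b1 - b2; pose delta := b1 * b2.
pose C3 := a2 * kap + 1 + C2.
pose C4 := b1 * (C1 * C2 + C2) + a1 * kap * (1 + C2) + (1 + C3).
have C30 : 0 < C3 by rewrite /C3; lra.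
have C40 : 0 < C4.
  have := mulr_gt0 b10 (addr_gt0 (mulr_gt0 C10 C20) C20).
  have : 0 < a1 * kap * (1 + C2) by rewrite mulr_gt0//; lra.
  by rewrite /C4; lra.
have [||l lmu|K hK] := @ratio_eventually_le al tau delta mu al0 _ mu0.
- exact: mulr_gt0.
- move=> e e0; pose e2 := Num.min 1 (e / C4).
  have e20 : 0 < e2 by rewrite lt_min ltr01 divr_gt0.
  have e21 : e2 <= 1 by rewrite ge_min lexx.
  have e2e : e2 * C4 <= e by rewrite -ler_pdivlMr// ge_min lexx orbT.
  have [K2 h2] := hrec _ e20.
  exists (maxn K1 K2) => k; rewrite geq_max => /andP[Kk1 Kk2].
  have [r1 _] := h2 k Kk2; have [r3 r2] := h2 k.+1 (leqW Kk2).
  have c1 := alC k Kk1; have c2 := beC k.+1 (leqW Kk1).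
  move: r1 r2 r3 c1 c2 (al0 k) (al0 k.+1) (al0 k.+2) (be0 k.+1) (be0 k.+2).
  move: (al k) (al k.+1) (al k.+2) (be k.+1) (be k.+2) => x0 x1 x2 y1 y2.
  move=> r1 r2 r3 c1 c2 p0 p1 p2 s1 s2.
  have c3 : x0 <= C1 * C2 * x1.
    by apply: (le_trans c1); rewrite -mulrA ler_pM2l.
  have c4 : y2 <= C3 * x1.
    move: r2; rewrite ler_norml => /andP[_ r2].
    have : e2 * (x1 + y1) <= x1 + C2 * x1 by clear -e20 e21 p1 s1 c2; nra.
    have : 0 < b1 * y1 by rewrite mulr_gt0.
    by rewrite /C3 !mulrDl mul1r; lra.
  have d1 : b1 * (x1 - (a1 * kap * y1 - b2 * x0)) <= b1 * (e2 * ((C1 * C2 + C2) * x1)).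
    rewrite ler_pM2l//; apply: (le_trans (ler_norm _)); apply: (le_trans r1).
    by rewrite ler_pM2l// mulrDl lerD.
  have d2 : a1 * kap * (y2 - (a2 * kap * x1 - b1 * y1)) <= a1 * kap * (e2 * ((1 + C2) * x1)).
    rewrite ler_pM2l//; apply: (le_trans (ler_norm _)); apply: (le_trans r2).
    by rewrite ler_pM2l// mulrDl mul1r lerD2l.
  have d3 : x2 - (a1 * kap * y2 - b2 * x1) <= e2 * ((1 + C3) * x1).
    apply: (le_trans (ler_norm _)); apply: (le_trans r3).
    by rewrite ler_pM2l// mulrDl mul1r lerD2l.
  have d4 : e2 * C4 * x1 <= e * x1 by rewrite ler_pM2r.
  rewrite /tau /delta; rewrite /C4 in d4.
  by clear -d1 d2 d3 d4; nra.
- apply: contraNneq (hroot l kap0 lmu) => lm; rewrite -subr_eq0 -lm; apply/eqP.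
  by rewrite /tau /delta; ring.
exists C2, (maxn K K1); split => // k; rewrite geq_max => /andP[p1 p2].
  exact: hK.
exact: beC.
Qed.

End Recursion.

(** * Eigenvalues of the linearised operator *)

Section Spectrum.
Context {R : realType} {n : nat}.
Implicit Types (u v w : 'rV[R]_n) (a l : R).

Lemma relax_hyperplane u v a : enorm u = 1 ->
  relax a (projC [set w | dotv u w = 0]) v = v - (a * dotv u v) *: u.
Proof.
move=> u1; have uu : dotv u u = 1 by rewrite -enorm_sqr u1 expr1n.
set C := [set w | _]; pose p := v - dotv u v *: u.
have Cp : C p by rewrite /C /= /p dotvBr dotvZr uu mulr1 subrr.
have vp : v - p = dotv u v *: u by rewrite /p subKr.
have orth y : C y -> dotv (v - p) (y - p) = 0.
  by rewrite vp dotvZl dotvBr => ->; rewrite (Cp : dotv u p = 0) subrr mulr0.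
have pP : is_proj C v p.
  split => // y Cy; apply: enorm_le; first exact: enorm_ge0.
  have := orth y Cy; rewrite enorm_sqr.
  have -> : v - y = (v - p) - (y - p) by apply/rowP => i; rewrite !mxE; ring.
  have := dotvv_ge0 (y - p).
  by move: (v - p) (y - p) => r s; rewrite !dotvE (dotvC s r); lra.
(* [projC] is a chosen nearest point, so uniqueness is what identifies it with [p]. *)
have -> : relax a (projC C) v = relax a (fun _ => p) v.
  rewrite /relax; congr (_ + _ *: _).
  apply: (is_proj_unique Cp _ (xgetPex 0 (ex_intro _ p pP))) => y Cy.
  by rewrite orth.
by rewrite relaxE vp scalerA.
Qed.

Lemma mul_mat_of (f : 'rV[R]_n -> 'rV[R]_n) v :
  (forall a u w, f (a *: u + w) = a *: f u + f w) -> v *m mat_of f = f v.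
Proof.
move=> lf; have f0 : f 0 = 0.
  by have := lf 1 0 0; rewrite scaler0 add0r scale1r => /eqP; rewrite -subr_eq subrr eq_sym => /eqP.
rewrite [in RHS](row_sum_delta v).
rewrite (_ : f _ = \sum_(i < n) v 0 i *: f (delta_mx 0 i)); last first.
  by elim/big_rec2: _ => // i y1 y2 _ <-; rewrite lf.
apply/rowP => j; rewrite mxE summxE; apply: eq_bigr => i _.
by rewrite !mxE.
Qed.

Lemma cmod_bounded_roots (p : {poly R[i]}) : p != 0 ->
  exists M : R, forall z, root p z -> cmod z <= M.
Proof.
move=> p0; have [r pE] := closed_field_poly_normal p.
exists (\sum_(z <- r) cmod z) => l; rewrite pE rootZ ?lead_coef_eq0// root_prod_XsubC => lr.
rewrite (big_rem l)//= lerDl; apply: sumr_ge0 => z _; exact: sqrtr_ge0.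
Qed.

(** A [sup] dominates its set only when the set is bounded; here the eigenvalues are roots of the
    characteristic polynomial. *)
Lemma gamma_has_ubound (M : 'M[R]_n) :
  has_ubound [set r : R | r = 0 \/ exists l : R[i],
    eigenvalue (map_mx (fun a : R => a%:C%C) M) l /\ l != 1 /\ r = cmod l].
Proof.
have [b bP] := cmod_bounded_roots (monic_neq0 (char_poly_monic (map_mx (fun a : R => a%:C%C) M))).
exists (Num.max 0 b) => r [->|[z [ez [_ ->]]]]; first by rewrite le_max lexx.
by rewrite le_max bP ?orbT// -eigenvalue_root_char.
Qed.

Lemma gamma_ge0 (M : 'M[R]_n) : 0 <= gamma M.
Proof. by apply: ub_le_sup; [exact: gamma_has_ubound|left]. Qed.

Lemma gamma_ge_eigenvalue (M : 'M[R]_n) v l : v != 0 -> v *m M = l *: v -> 0 <= l -> l != 1 ->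
  l <= gamma M.
Proof.
move=> v0 vM l0 l1; apply: ub_le_sup; first exact: gamma_has_ubound.
right; exists (l%:C)%C; split; last split.
- apply/eigenvalueP; exists (map_mx (fun a : R => a%:C%C) v).
    by rewrite -(map_mxM (real_complex R)) vM (map_mxZ (real_complex R)).
  by rewrite (map_mx_eq0 (real_complex R)).
- by rewrite (_ : 1 = (1 : R)%:C%C)// (inj_eq (@complexI R)).
by rewrite /cmod /= expr0n addr0 sqrtr_sqr ger0_norm.
Qed.

Variables (uA uB : 'rV[R]_n) (uA1 : enorm uA = 1) (uB1 : enorm uB = 1) (a1 a2 : R).
Let PA := [set w | dotv uA w = 0].
Let PB := [set w | dotv uB w = 0].
Let kap := - dotv uA uB.

Lemma S_T_hyperplanes v : S_T a1 a2 PA PB v =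
  v - (a1 * dotv uB v) *: uB - (a2 * (dotv uA v + a1 * kap * dotv uB v)) *: uA.
Proof.
rewrite /S_T !relax_hyperplane// dotvBr dotvZr; congr (_ - (a2 * _) *: _).
by rewrite /kap; ring.
Qed.

Lemma mul_mat_of_S_T v : v *m mat_of (S_T a1 a2 PA PB) = S_T a1 a2 PA PB v.
Proof.
apply: mul_mat_of => a u w; rewrite !S_T_hyperplanes !dotvDr !dotvZr.
by apply/rowP => i; rewrite !mxE; ring.
Qed.

(** [S_T] preserves the span of [uA] and [uB], where its characteristic equation is the displayed
    quadratic. The value [l = 1] would force [kap^2 = 1]. *)
Lemma gamma_ge_root l : 1 < a1 -> 1 < a2 -> 0 < kap < 1 -> 0 < l ->
  (l + (a1 - 1)) * (l + (a2 - 1)) = a1 * a2 * kap ^+ 2 * l ->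
  l <= gamma (mat_of (S_T a1 a2 PA PB)).
Proof.
move=> g1 g2 /andP[k0 k1] l0 lq.
have uAA : dotv uA uA = 1 by rewrite -enorm_sqr uA1 expr1n.
have uBB : dotv uB uB = 1 by rewrite -enorm_sqr uB1 expr1n.
have uAB : dotv uA uB = - kap by rewrite opprK.
have uBA : dotv uB uA = - kap by rewrite dotvC.
pose v := (l + (a1 - 1)) *: uA + (a1 * kap) *: uB.
have vA : dotv uA v = l + (a1 - 1) - a1 * kap ^+ 2.
  by rewrite dotvDr !dotvZr uAA uAB; ring.
have vB : dotv uB v = - (l - 1) * kap.
  by rewrite dotvDr !dotvZr uBB uBA; ring.
apply: (@gamma_ge_eigenvalue _ v); last 2 first.
- exact: ltW.
- apply/eqP => l1; move: lq; rewrite l1 => lq.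
  have : 0 < a1 * a2 * (1 - kap ^+ 2).
    by rewrite !mulr_gt0 ?subr_gt0 ?expr_lt1// ?ltW//; lra.
  by nra.
- apply/eqP => v0; move: vA vB; rewrite v0 -(scale0r 0) !dotvZr !mul0r => vA vB.
  have : (l - 1) * kap = 0 by lra.
  move=> /eqP; rewrite mulf_eq0 (gt_eqF k0) orbF subr_eq0 => /eqP l1.
  move: vA; rewrite l1; have : kap ^+ 2 < 1 by rewrite expr_lt1// ltW.
  by nra.
rewrite mul_mat_of_S_T S_T_hyperplanes vA vB.
have e1 : a1 * kap - a1 * (- (l - 1) * kap) = l * (a1 * kap) by ring.
have e2 : l + (a1 - 1) - a2 * (l + (a1 - 1) - a1 * kap ^+ 2 + a1 * kap * (- (l - 1) * kap))
  = l * (l + (a1 - 1)).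
  have -> : l + (a1 - 1) - a2 * (l + (a1 - 1) - a1 * kap ^+ 2 + a1 * kap * (- (l - 1) * kap))
    = l * (l + (a1 - 1)) + (a1 * a2 * kap ^+ 2 * l - (l + (a1 - 1)) * (l + (a2 - 1))) by ring.
  by rewrite lq subrr addr0.
rewrite /v scalerDr !scalerA -e1 -e2.
by apply/rowP => i; rewrite !mxE; ring.
Qed.

(** The two hyperplanes coincide, and the relaxed projections multiply their common normal by
    [1 - a1] and [1 - a2]. *)
Lemma gamma_ge_antipodal : 1 < a1 < 2 -> 1 < a2 < 2 -> uB = - uA ->
  (a1 - 1) * (a2 - 1) <= gamma (mat_of (S_T a1 a2 PA PB)).
Proof.
move=> /andP[g1 l1] /andP[g2 l2] uE.
have uAA : dotv uA uA = 1 by rewrite -enorm_sqr uA1 expr1n.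
apply: (@gamma_ge_eigenvalue _ uA).
- by apply/eqP => u0; move: uAA; rewrite u0 -(scale0r 0) dotvZl mul0r => /esym/eqP; rewrite oner_eq0.
- rewrite mul_mat_of_S_T S_T_hyperplanes /kap uE dotvNl dotvNr uAA.
  by apply/rowP => i; rewrite !mxE; ring.
- by rewrite mulr_ge0// subr_ge0 ltW.
- by rewrite lt_eqF//; nra.
Qed.

End Spectrum.

(** * Consequences of a limit normal: absorption, support and flatness *)

Section LimitNormals.
Context {R : realType} {n : nat}.
Implicit Types (A C : set 'rV[R]_n) (u v w x y z N M : 'rV[R]_n) (a e : R).

Lemma dotv_unit u : enorm u = 1 -> dotv u u = 1.
Proof. by move=> u1; rewrite -enorm_sqr u1 expr1n. Qed.

Lemma dotv_close u v N M e : enorm u = 1 -> enorm M = 1 ->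
  enorm (N - u) < e -> enorm (M - v) < e -> `|dotv N M - dotv u v| <= 2 * e.
Proof.
move=> u1 M1 Nu Mv.
have -> : dotv N M - dotv u v = dotv (N - u) M + dotv u (M - v).
  by rewrite dotvBl dotvBr; ring.
apply: (le_trans (ler_normD _ _)).
have := dotv_abs (N - u) M; have := dotv_abs u (M - v); rewrite u1 M1; lra.
Qed.

Lemma relax_dist_le C a x z : closed_convex C -> 0 <= a <= 2 -> C x ->
  enorm (relax a (projC C) z - x) <= enorm (z - x).
Proof.
move=> cC /andP[a0 a2] Cx; rewrite -(@ler_pXn2r _ 2)// ?nnegrE ?enorm_ge0//.
apply: (le_trans (relax_fejer z cC a0 Cx)).
by rewrite gerBl !mulr_ge0 ?subr_ge0 ?pdist_ge0.
Qed.

Definition absorbs C a x := exists2 d, 0 < d &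
  forall z, enorm (z - x) < d -> C (relax a (projC C) z).

Lemma interior_absorbs C a x : closed_convex C -> 1 < a < 2 -> C° x -> absorbs C a x.
Proof.
move=> cC /andP[a1 a2] Cx; have [r r0 rC] := (interior_enorm _ _).1 Cx.
exists r => // z zr; apply: rC; apply: le_lt_trans zr.
by apply: relax_dist_le (interior_subset Cx) => //; lra.
Qed.

(* If w = p - (a - 1) d N were outside C, with unit normal N' at its projection p', then
   0 < <N', w - p'> <= - (a - 1) d <N', N>, although N and N' are both close to u. *)
Lemma limit_normal_absorbs C a x u : closed_convex C -> 1 < a < 2 -> C x ->
  limit_normal C x u -> absorbs C a x.
Proof.
move=> cC /andP[a1 a2] Cx [u1 lim].
have e0 : 0 < 1 / 4 :> R by lra.
have [d d0 dP] := lim _ e0; exists d => // z zd.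
have [Cz|nCz] := pselect (C z); first by rewrite relax_in.
apply: contrapT; set w := relax a _ z => nCw.
have wd : enorm (w - x) < d.
  by apply: le_lt_trans zd; apply: relax_dist_le => //; lra.
have NN := dotv_close u1 (enorm_pnormal cC nCw) (dP _ nCz zd) (dP _ nCw wd).
have Np := pnormal_le0 cC nCw (projC_in z cC).
have e1 : projC C z - projC C w =
    pdist C w *: pnormal C w + ((a - 1) * pdist C z) *: pnormal C z.
  rewrite -(pnormalE cC nCw); move: (projC C w) => q.
  by rewrite /w (relax_projC cC nCz); apply/rowP => i; rewrite !mxE; ring.
move: Np NN (dotv_pnormal cC nCw) (pdist_gt0 cC nCw) (pdist_gt0 cC nCz).
rewrite e1 (dotv_unit u1); clear -a1.
move: (pnormal C z) (pnormal C w) (pdist C z) (pdist C w) => N N' d d'.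
rewrite !dotvE (dotvC N' N) ler_norml => Np /andP[NN _] N'1 d'0 d0.
have : 0 < (a - 1) * d * dotv N N' by rewrite !mulr_gt0 ?subr_gt0//; lra.
by rewrite N'1 in Np; lra.
Qed.

Definition outer_limit A x := forall d, 0 < d -> exists2 z, ~ A z & enorm (z - x) < d.

Lemma limit_normal_unique A x u v : outer_limit A x ->
  limit_normal A x u -> limit_normal A x v -> u = v.
Proof.
move=> oA [_ lu] [_ lv]; apply/eqP; rewrite -subr_eq0; apply/eqP/enorm_eq0/eqP.
rewrite eq_le enorm_ge0 andbT leNgt; apply/negP => e0.
have e2 : 0 < enorm (u - v) / 2 by lra.
have [d d0 dP] := lu _ e2; have [d' d'0 d'P] := lv _ e2.
have [|z nAz] := oA (Num.min d d'); first by rewrite lt_min d0.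
rewrite lt_min => /andP[zd zd'].
have := enorm_triangle (pnormal A z) u v; rewrite (enormC u (pnormal A z)).
have := dP _ nAz zd; have := d'P _ nAz zd'; lra.
Qed.

(** This is [<N, y - p> <= 0] in the limit of outside points tending to [x]. *)
Lemma limit_normal_supports A x u y : closed_convex A -> A x -> outer_limit A x ->
  limit_normal A x u -> A y -> dotv u (y - x) <= 0.
Proof.
move=> cA Ax oA [u1 lu] Ay; rewrite leNgt; apply/negP => s0.
set s := dotv _ _ in s0; pose K := enorm (y - x) + 1.
have K0 : 0 < K by rewrite ltr_wpDl ?enorm_ge0.
(* Replacing [u] by [N] then costs at most [s / 2], and replacing [x] by the projection less than
   [s / 4], so [<N, y - p>] would stay positive. *)
have e0 : 0 < s / 2 / K by rewrite !divr_gt0.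
have [d d0 dP] := lu _ e0.
have [|z nAz] := oA (Num.min d (s / 8)); first by rewrite lt_min d0 divr_gt0.
rewrite lt_min => /andP[zd zs].
have := pnormal_le0 cA nAz Ay; set N := pnormal A z; set p := projC A z.
have N1 : enorm N = 1 by exact: enorm_pnormal.
have px : enorm (p - x) <= 2 * enorm (z - x) by exact: projC_dist.
have -> : y - p = (y - x) - (p - x) by apply/rowP => i; rewrite !mxE; ring.
rewrite dotvBr.
have := dotv_le N (p - x); rewrite N1 mul1r.
have := dotv_le (u - N) (y - x); rewrite dotvBl -/s (enormC u N).
have : enorm (N - u) * enorm (y - x) <= s / 2.
  have := dP _ nAz zd; rewrite -/N ltr_pdivlMr// => /ltW; apply: le_trans.
  by rewrite ler_wpM2l ?enorm_ge0// /K lerDl.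
lra.
Qed.

(** [A] lies on one side of the hyperplane and contains a disc of it. Testing the obtuse angle at
    [p] against points of this disc puts [p] on the hyperplane and then removes the tangential part
    of [N]. *)
Lemma limit_normal_flat A x u r : closed_convex A -> A x -> limit_normal A x u ->
  (forall y, A y -> dotv u (y - x) <= 0) -> 0 < r ->
  (forall v, dotv u v = 0 -> enorm v <= r -> A (x + v)) ->
  exists2 d, 0 < d & forall z, ~ A z -> enorm (z - x) < d ->
    pnormal A z = u /\ dotv u (projC A z - x) = 0.
Proof.
move=> cA Ax [u1 lu] sup r0 patch; have uu := dotv_unit u1.
have [d d0 dP] := lu (1 / 2) ltac:(lra).
exists (Num.min d (r / 4)); first by rewrite lt_min d0 divr_gt0.
move=> z nAz; rewrite lt_min => /andP[zd zr].
set N := pnormal A z; set p := projC A z.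
have N1 : enorm N = 1 by exact: enorm_pnormal.
have NN := dotv_unit N1.
have px : enorm (p - x) <= r / 2 by have := projC_dist z cA Ax; rewrite -/p; lra.
have Nle y : A y -> dotv N (y - p) <= 0 by exact: pnormal_le0.
have Nu : 0 < dotv N u.
  have := dP _ nAz zd; rewrite -/N => h.
  have := dotv_subZ 1 N u; rewrite scale1r -enorm_sqr NN uu.
  by have := enorm_ge0 (N - u); nra.
pose s := dotv u (p - x).
have s0 : s = 0.
  apply/eqP; rewrite eq_le sup ?andTb; last exact: projC_in.
  have : A (x + ((p - x) - s *: u)).
    apply: patch; first by rewrite dotvBr dotvZr uu mulr1 subrr.
    apply: (@le_trans _ _ (enorm (p - x))); last by lra.
    apply: enorm_le; first exact: enorm_ge0.
    rewrite dotv_subZ enorm_sqr uu (dotvC (p - x)) -/s.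
    by have := sqr_ge0 s; lra.
  move=> /Nle.
  have -> : x + (p - x - s *: u) - p = - s *: u by apply/rowP => i; rewrite !mxE; ring.
  by rewrite dotvZr pmulr_lle0// oppr_le0.
pose b := dotv N u.
pose T := N - b *: u.
have uT : dotv u T = 0 by rewrite dotvBr dotvZr uu (dotvC u) mulr1 subrr.
have TT : dotv T T = 1 - b ^+ 2 by rewrite dotv_subZ NN uu -/b; ring.
have NT : dotv N T = 1 - b ^+ 2 by rewrite dotvBr dotvZr NN -/b; ring.
have T1 : enorm T <= 1 by apply: enorm_le => //; rewrite TT; have := sqr_ge0 b; lra.
have : A (x + ((p - x) + (r / 2) *: T)).
  apply: patch; first by rewrite dotvDr dotvZr uT mulr0 addr0 -/s s0.
  apply: (le_trans (enormD _ _)); rewrite enormZ gtr0_norm ?divr_gt0//.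
  have : r / 2 * enorm T <= r / 2 by rewrite ger_pMr// divr_gt0.
  lra.
move=> /Nle.
have -> : x + (p - x + (r / 2) *: T) - p = (r / 2) *: T by apply/rowP => i; rewrite !mxE; ring.
rewrite dotvZr pmulr_rle0 ?divr_gt0// NT => h.
have T0 : T = 0 by apply: dotvv_eq0; apply/eqP; rewrite eq_le dotvv_ge0 TT h.
have b1 : b = 1.
  have : (b - 1) * (b + 1) = 0 by move: TT; rewrite T0 -(scale0r 0) dotvZl mul0r; lra.
  move/eqP; rewrite mulf_eq0 => /orP[|]; first by rewrite subr_eq0 => /eqP.
  by rewrite gt_eqF// ltr_wpDr.
by split => //; apply/eqP; rewrite -subr_eq0 -[u]scale1r -b1; apply/eqP.
Qed.

(** The chart of the intersection has a hyperplane as kernel, hence rank one, so it has a zero over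
    every small tangent vector. Such a zero lies in both sets, and flatness makes its transversal
    offset vanish. *)
Lemma flat_patch A B x u k d U (F : 'rV[R]_n -> 'rV[R]_d) : closed A -> closed B ->
  bd A x -> bd B x -> is_chart k.+1 (bd A `&` bd B) x U F -> enorm u = 1 ->
  tker F x = [set v | dotv u v = 0] ->
  (forall y, A y -> B y -> dotv u (y - x) = 0) ->
  exists2 r, 0 < r & forall v, dotv u v = 0 -> enorm v <= r -> A (x + v) /\ B (x + v).
Proof.
move=> clA clB bA bB [oU Ux [dF _] sF FU] u1 kF flat; have uu := dotv_unit u1.
have nU : nbhs x U by exact: open_nbhs_nbhs.
have Fx : F x = 0 by exact/FU.
have Lu : 'd F x (- u) != 0.
  apply/eqP => Lu; have : tker F x (- u) by [].
  by rewrite kF /= dotvNr uu => /eqP; rewrite oppr_eq0 oner_eq0.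
have rk w : exists s : R, 'd F x w = s *: 'd F x (- u).
  exists (- dotv u w); have : tker F x (w - dotv u w *: u).
    by rewrite kF /= dotvBr dotvZr uu mulr1 subrr.
  rewrite /tker /= linearB linearZ => /eqP; rewrite subr_eq0 => /eqP ->.
  by rewrite linearN scalerN scaleNr opprK.
have [c [j [v [v1 uv kF' F0 fo]]]] := scalar_chart (dF x Ux) Fx (sF x Ux) Lu rk.
have kE w : dotv u w = 0 <-> dotv v w = 0.
  by have : [set w | dotv u w = 0] w = [set w | dotv v w = 0] w; [rewrite -kF kF'|move=> /= ->].
have cF y : U y -> {for y, continuous (fun z => c * F z 0 j)}.
  by move=> /dF; exact: scaled_coord_continuous.
have one01 : 0 < (1 : R) <= 1 by rewrite ltr01 lexx.
have [t t0 tP] := zero_on_transversal nU cF v1 fo one01.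
exists t => // w uw wt.
have vw : dotv v (t^-1 *: w) = 0 by rewrite dotvZr (kE w).1// mulr0.
have w1 : enorm (t^-1 *: w) <= 1.
  by rewrite enormZ gtr0_norm ?invr_gt0// mulrC ler_pdivrMr// mul1r.
have [s [_ Us fs]] := tP _ vw w1.
have [[/clA As _] [/clB Bs _]] := (FU _ Us).2 (F0 _ fs).
have := flat _ As Bs; rewrite addrAC subrr add0r dotvZr dotvDr !dotvZr uw mulr0 add0r.
move=> /eqP; rewrite !mulf_eq0 (gt_eqF t0) /= => /orP[/eqP s0|/eqP/kE]; last first.
  by move=> /eqP; rewrite dotv_unit// oner_eq0.
move: As Bs; rewrite s0 scale0r addr0 scalerA divff ?gt_eqF// scale1r.
by split.
Qed.

End LimitNormals.

(** * Dynamics outside the sets *)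

Section Rates.
Context {R : realType} {n : nat}.

(** Both bounds come from the supporting half-spaces at the two projections. When the two normals
    have a common limit, the sandwich determines the new distance to first order. *)
Lemma pdist_between (C : set 'rV[R]_n) z z' : closed_convex C -> ~ C z -> ~ C z' ->
  dotv (pnormal C z) (z' - projC C z) <= pdist C z' <= dotv (pnormal C z') (z' - projC C z).
Proof.
move=> cC nz nz'.
have h1 := pnormal_le0 cC nz (projC_in z' cC).
have h2 := pnormal_le0 cC nz' (projC_in z cC).
have h3 := dotv_le (pnormal C z) (pnormal C z').
rewrite (enorm_pnormal cC nz) (enorm_pnormal cC nz') mulr1 in h3.
have e1 : z' - projC C z = pdist C z' *: pnormal C z' + (projC C z' - projC C z).
  by rewrite -(pnormalE cC nz') addrA subrK.
have e2 : projC C z' - projC C z = - (projC C z - projC C z') by rewrite opprB.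
have d0 := pdist_gt0 cC nz'; have N1 := dotv_pnormal cC nz'.
rewrite e1; rewrite e2 in h1 *.
move: h1 h2 h3 d0 N1; clear.
move: (pnormal C z) (pnormal C z') (pdist C z') (projC C z - projC C z') => N N' d r.
rewrite !dotvE => h1 h2 h3 d0 ->; rewrite mulr1.
have : d * dotv N N' <= d by rewrite ger_pMr.
by move=> h4; lra.
Qed.

Lemma linear_rate (x : nat -> 'rV[R]_n) (xs : 'rV[R]_n) (s : nat -> R) (D mu M : R) K :
  0 < mu < 1 -> (forall k, 0 <= s k) -> 0 <= D -> x @ \oo --> xs ->
  (forall k, enorm (x k - xs) <= M) ->
  (forall k, (K <= k)%N -> s k.+1 <= mu * s k) ->
  (forall k, (K <= k)%N -> enorm (x k.+1 - x k) <= D * s k) ->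
  exists C : R, 0 < C /\ forall k, enorm (x k - xs) <= C * mu ^+ k.
Proof.
move=> /andP[mu0 mu1] s0 D0 xcv xM smu xD.
have m1 : 0 < 1 - mu by rewrite subr_gt0.
have tele j : forall k, (K <= k)%N -> enorm (x k - x (k + j)%N) <= D * s k / (1 - mu).
  elim: j => [|j IH] k Kk.
    by rewrite addn0 subrr enorm0 divr_ge0 ?mulr_ge0// ltW.
  have h := enorm_triangle (x k.+1) (x k) (x (k + j.+1)%N).
  have h1 := IH k.+1 (leqW Kk); rewrite addSnnS in h1.
  have h2 := xD _ Kk; rewrite enormC in h2.
  have h3 : D * s k.+1 <= D * (mu * s k) by rewrite ler_wpM2l// smu.
  apply: (le_trans h).
  rewrite ler_pdivlMr//; rewrite ler_pdivlMr// in h1.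
  by move: h1 h2 h3 m1; clear; nra.
have lim k : (K <= k)%N -> enorm (x k - xs) <= D * s k / (1 - mu).
  move=> Kk; apply/ler_addgt0Pr => e e0.
  have nU : nbhs xs [set z | enorm (z - xs) < e] by apply/nbhs_enorm; exists e.
  have [N _ NP] := xcv _ nU.
  have xe : enorm (x (k + N)%N - xs) < e by apply: NP; rewrite /= leq_addl.
  have := enorm_triangle (x (k + N)%N) (x k) xs; have := tele N k Kk; lra.
have sK j : s (K + j)%N <= mu ^+ j * s K.
  elim: j => [|j IH]; first by rewrite addn0 mul1r.
  by rewrite addnS exprS -mulrA (le_trans (smu _ (leq_addr _ _)))// ler_pM2l.
have M0 : 0 <= M := le_trans (enorm_ge0 _) (xM 0%N).
have muK : 0 < mu ^+ K by rewrite exprn_gt0.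
pose E := D * s K / (1 - mu).
have E0 : 0 <= E by rewrite divr_ge0 ?mulr_ge0// ltW.
(* [M] covers the indices before [K], [E] the geometric tail from [K] on; the division by [mu ^+ K]
   shifts the tail back to index 0. *)
exists ((M + E + 1) / mu ^+ K); split; first by rewrite divr_gt0//; lra.
move=> k; rewrite mulrAC ler_pdivlMr//; have [Kk|kK] := leqP K k.
  rewrite -(subnKC Kk); set j := (k - K)%N.
  have muj : 0 < mu ^+ j by rewrite exprn_gt0.
  have := lim _ (leq_addr j K); have := sK j => h1 h2.
  have : D * s (K + j)%N / (1 - mu) <= E * mu ^+ j.
    rewrite /E [leRHS]mulrAC ler_pM2r ?invr_gt0// -mulrA ler_wpM2l//.
    by rewrite [leRHS]mulrC.
  rewrite exprD mulrA mulrAC ler_pM2r// => h3.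
  apply: (le_trans h2); apply: (le_trans h3); rewrite ler_pM2r//; lra.
have : mu ^+ K <= mu ^+ k by apply: ler_wiXn2l; rewrite ?ltW// ltnW.
have := xM k; have := enorm_ge0 (x k - xs).
have : 0 < mu ^+ k by rewrite exprn_gt0.
move: E0 M0 muK; clear; nra.
Qed.

Variables (A B : set 'rV[R]_n) (cA : closed_convex A) (cB : closed_convex B).
Variables (a1 a2 : R) (ha1 : 1 < a1 < 2) (ha2 : 1 < a2 < 2).
Variable x : nat -> 'rV[R]_n.
Hypothesis xS : forall k, x k.+1 = relax a2 (projC A) (relax a1 (projC B) (x k)).
Let y k := relax a1 (projC B) (x k).

Variable K0 : nat.
Hypothesis nB : forall k, (K0 <= k)%N -> ~ B (x k).
Hypothesis nA : forall k, (K0 <= k)%N -> ~ A (y k).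

Let N k := pnormal A (y k).
Let M k := pnormal B (x k).
Let al k := pdist A (y k).
Let be k := pdist B (x k).

Lemma y_step k : (K0 <= k)%N -> y k = projC B (x k) - ((a1 - 1) * be k) *: M k.
Proof. by move=> Kk; rewrite /y (relax_projC cB (nB Kk)). Qed.

Lemma y_drop k : (K0 <= k)%N -> y k = x k - (a1 * be k) *: M k.
Proof. by move=> Kk; rewrite /y relaxE (pnormalE cB (nB Kk)) scalerA. Qed.

Lemma x_step k : (K0 <= k)%N -> x k.+1 = projC A (y k) - ((a2 - 1) * al k) *: N k.
Proof. by move=> Kk; rewrite xS -/(y k) (relax_projC cA (nA Kk)). Qed.

Lemma x_drop k : (K0 <= k)%N -> x k.+1 = y k - (a2 * al k) *: N k.
Proof. by move=> Kk; rewrite xS -/(y k) relaxE (pnormalE cA (nA Kk)) scalerA. Qed.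

Lemma step_bound k : (K0 <= k)%N -> enorm (x k.+1 - x k) <= a1 * be k + a2 * al k.
Proof.
move=> Kk; have [/andP[g1 _] /andP[g2 _]] := conj ha1 ha2.
rewrite (x_drop Kk) (y_drop Kk) addrAC (addrAC (x k)) subrr add0r.
apply: (le_trans (enormD _ _)); rewrite !enormN (enormZ _ (M k)) (enormZ _ (N k)).
rewrite (enorm_pnormal cB (nB Kk)) (enorm_pnormal cA (nA Kk)) !mulr1.
have b0 : 0 <= be k := pdist_ge0 _ _.
have c0 : 0 <= al k := pdist_ge0 _ _.
by rewrite !ger0_norm// mulr_ge0//; lra.
Qed.

Variables (xs uA uB : 'rV[R]_n).
Hypothesis xcv : forall e, 0 < e -> exists K, forall k, (K <= k)%N ->
  enorm (x k - xs) < e /\ enorm (y k - xs) < e.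
Hypothesis lA : limit_normal A xs uA.
Hypothesis lB : limit_normal B xs uB.

Let kap := - dotv uA uB.

Lemma normals_cvg e : 0 < e -> exists K, forall k, (K <= k)%N ->
  [/\ (K0 <= k)%N, enorm (N k - uA) < e & enorm (M k - uB) < e].
Proof.
move=> e0; case: lA lB => [_ lA'] [_ lB'].
have [d d0 dP] := lA' _ e0; have [d' d'0 d'P] := lB' _ e0.
have m0 : 0 < Num.min d d' by rewrite lt_min d0.
have [K KP] := xcv m0; exists (maxn K0 K) => k; rewrite geq_max => /andP[k0 /KP[]].
rewrite !lt_min => /andP[x1 x2] /andP[y1 y2].
by split => //; [exact: dP (nA k0) y1|exact: d'P (nB k0) x2].
Qed.

Lemma distances_recursion e : 0 < e -> exists K, forall k, (K <= k)%N ->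
  `|al k.+1 - (a1 * kap * be k.+1 - (a2 - 1) * al k)| <= e * (al k + be k.+1) /\
  `|be k.+1 - (a2 * kap * al k - (a1 - 1) * be k)| <= e * (al k + be k).
Proof.
(* Normals within [e / 4] of their limits give inner products within [e / 2]; the coefficients [a1]
   and [a2] are below 2, the others below 1. *)
move=> e0; have e4 : 0 < e / 4 by rewrite divr_gt0.
have [K KP] := normals_cvg e4; exists K => k Kk.
have [k0 Nk Mk] := KP k Kk; have [k0' Nk' Mk'] := KP k.+1 (leqW Kk).
have [uA1 uB1] : enorm uA = 1 /\ enorm uB = 1 by case: lA lB => ? _ [? _].
have [/andP[g1 l1] /andP[g2 l2]] := conj ha1 ha2.
have := pdist_between cA (nA k0) (nA k0'); have := pdist_between cB (nB k0) (nB k0').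
rewrite -/(N k) -/(N k.+1) -/(M k) -/(M k.+1) -/(al k.+1) -/(be k.+1).
have eA : y k.+1 - projC A (y k) = - ((a2 - 1) * al k) *: N k - (a1 * be k.+1) *: M k.+1.
  by rewrite (y_drop k0') (x_step k0) scaleNr addrC addrA (addrA (- _)) addNr add0r.
have eB : x k.+1 - projC B (x k) = - ((a1 - 1) * be k) *: M k - (a2 * al k) *: N k.
  by rewrite (x_drop k0) (y_step k0) scaleNr addrC addrA (addrA (- _)) addNr add0r.
rewrite eA eB.
have N1 : enorm (N k) = 1 := enorm_pnormal cA (nA k0).
have N1' : enorm (N k.+1) = 1 := enorm_pnormal cA (nA k0').
have M1 : enorm (M k) = 1 := enorm_pnormal cB (nB k0).
have M1' : enorm (M k.+1) = 1 := enorm_pnormal cB (nB k0').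
have h1 := dotv_close uA1 M1' Nk Mk'.
have h2 := dotv_close uA1 M1' Nk' Mk'.
have h3 := dotv_close uA1 N1 Nk' Nk; rewrite (dotv_unit uA1) in h3.
have h4 := dotv_close uA1 M1 Nk Mk.
have h5 := dotv_close uB1 N1 Mk' Nk; rewrite (dotvC uB) in h5.
have h6 := dotv_close uB1 M1 Mk' Mk; rewrite (dotv_unit uB1) in h6.
have NN := dotv_unit N1; have MM := dotv_unit M1.
have kapE : dotv uA uB = - kap by rewrite opprK.
have al0 : 0 <= al k := pdist_ge0 _ _.
have be0 : 0 <= be k := pdist_ge0 _ _.
have be0' : 0 <= be k.+1 := pdist_ge0 _ _.
move: h1 h2 h3 h4 h5 h6 NN MM al0 be0 be0'; rewrite kapE.
move: (al k) (al k.+1) (be k) (be k.+1) (N k) (N k.+1) (M k) (M k.+1) kap.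
clear -g1 l1 g2 l2 e0 => p p' q q' n0 n1 m0 m1 c.
rewrite !dotvE !ler_norml (dotvC m0 n0) => /andP[h1 h1'] /andP[h2 h2'] /andP[h3 h3'].
move=> /andP[h4 h4'] /andP[h5 h5'] /andP[h6 h6'] -> -> p0 q0 q0'.
have P1 : 0 <= a1 * q' by rewrite mulr_ge0//; lra.
have P2 : 0 <= (a2 - 1) * p by rewrite mulr_ge0//; lra.
have P3 : 0 <= (a1 - 1) * q by rewrite mulr_ge0//; lra.
have P4 : 0 <= a2 * p by rewrite mulr_ge0//; lra.
have Q1 : a1 * q' <= 2 * q' by rewrite ler_wpM2r//; lra.
have Q2 : (a2 - 1) * p <= p by rewrite ler_piMl//; lra.
have Q3 : (a1 - 1) * q <= q by rewrite ler_piMl//; lra.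
have Q4 : a2 * p <= 2 * p by rewrite ler_wpM2r//; lra.
have e4 : 0 <= e / 4 by lra.
have S1 := ler_wpM2l e4 Q1; have S2 := ler_wpM2l e4 Q2.
have S3 := ler_wpM2l e4 Q3; have S4 := ler_wpM2l e4 Q4.
move=> /andP[b1 b2] /andP[c1 c2].
have w1 := ler_wpM2l P1 h1'; have w2 := ler_wpM2l P1 h2.
have w3 := ler_wpM2l P2 h3; have w4 := ler_wpM2l P4 h4'.
have w5 := ler_wpM2l P4 h5; have w6 := ler_wpM2l P3 h6.
have z1 := mulr_ge0 (ltW e0) p0; have z2 := mulr_ge0 (ltW e0) q0; have z3 := mulr_ge0 (ltW e0) q0'.
by split; apply/andP; split; lra.
Qed.

End Rates.

(** * Finite termination, or the local rate of convergence *)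

Section LocalRate.
Context {R : realType} {n : nat}.

Lemma antipodal_unit (u v : 'rV[R]_n) : enorm u = 1 -> enorm v = 1 -> dotv u v = -1 -> v = - u.
Proof.
move=> u1 v1 uv; apply/eqP; rewrite -addr_eq0; apply/eqP/dotvv_eq0.
by rewrite !dotvE (dotvC v) uv !dotv_unit//; ring.
Qed.

Lemma condC_absorbs (A B : set 'rV[R]_n) a1 a2 xs : closed_convex A -> closed_convex B ->
  solid A -> solid B -> 1 < a1 < 2 -> 1 < a2 < 2 -> A xs -> B xs -> condC A B xs ->
  absorbs A a2 xs /\ absorbs B a1 xs.
Proof.
move=> cA cB sA sB ha1 ha2 Axs Bxs.
have bd_absorbs (C : set 'rV[R]_n) a k d U (F : 'rV[R]_n -> 'rV[R]_d) : closed_convex C ->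
    solid C -> 1 < a < 2 -> C xs -> bd C xs -> is_chart k.+1 (bd C) xs U F -> absorbs C a xs.
  move=> cC sC ha Cxs bC /(chart_limit_normal cC sC bC)[u [_ lC]].
  exact: limit_normal_absorbs lC.
case=> [[bA [bB [[|k] [// _ [UA [dA [FA [UB [dB [FB [_ [_ [_ [chA chB _ _]]]]]]]]]]]]]]|
  [iA [bB [U [d [F ch]]]]]|[bA [iB [U [d [F ch]]]]]|[iA iB]]; split.
- exact: bd_absorbs chA.
- exact: bd_absorbs chB.
- exact: interior_absorbs.
- exact: bd_absorbs ch.
- exact: bd_absorbs ch.
- exact: interior_absorbs.
- exact: interior_absorbs.
- exact: interior_absorbs.
Qed.

Variables (A B : set 'rV[R]_n) (cA : closed_convex A) (cB : closed_convex B).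
Hypotheses (sA : solid A) (sB : solid B).
Variables (a1 a2 : R) (ha1 : 1 < a1 < 2) (ha2 : 1 < a2 < 2).
Variable x : nat -> 'rV[R]_n.
Hypothesis xS : forall k, x k.+1 = relax a2 (projC A) (relax a1 (projC B) (x k)).
Let y k := relax a1 (projC B) (x k).
Variable xs : 'rV[R]_n.
Hypotheses (Axs : A xs) (Bxs : B xs) (xcv : x @ \oo --> xs).

Lemma iterates_cvg e : 0 < e -> exists K, forall k, (K <= k)%N ->
  enorm (x k - xs) < e /\ enorm (y k - xs) < e.
Proof.
move=> e0; have nU : nbhs xs [set z | enorm (z - xs) < e] by apply/nbhs_enorm; exists e.
have [K _ KP] := xcv nU; exists K => k /KP /= xk; split => //.
apply: le_lt_trans xk; apply: relax_dist_le => //.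
by case/andP: ha1 => h1 h2; apply/andP; split; lra.
Qed.

(** Eventually each relaxed projection lands in its own set. An iterate in [B] then solves the
    problem; an intermediate point in [A] is left fixed by the next step and does so too. *)
Lemma finite_or_outside : absorbs A a2 xs -> absorbs B a1 xs ->
  (exists k, A (x k) /\ B (x k)) \/
  exists K, forall k, (K <= k)%N -> ~ B (x k) /\ ~ A (y k).
Proof.
move=> [d d0 dP] [d' d'0 d'P].
have m0 : 0 < Num.min d d' by rewrite lt_min d0.
have [K KP] := iterates_cvg m0.
have yB k : (K <= k)%N -> B (y k).
  by move=> /KP[]; rewrite !lt_min => /andP[_ h] _; exact: d'P.
have xA k : (K <= k)%N -> A (x k.+1).
  by move=> /KP[_]; rewrite !lt_min xS => /andP[h _]; exact: dP.
have [fin|nfin] := pselect (exists k, A (x k) /\ B (x k)); [by left|right].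
(* The shift by one makes [x k] itself the result of an absorbing step onto [A]. *)
exists K.+1 => -[//|k] Kk; split=> [Bx|Ay]; apply: nfin.
  by exists k.+1; split => //; exact: xA.
exists k.+2; rewrite xS -/(y k.+1) relax_in//; split => //.
by apply: yB; exact: leqW.
Qed.

Variable K0 : nat.
Hypothesis nB : forall k, (K0 <= k)%N -> ~ B (x k).
Hypothesis nA : forall k, (K0 <= k)%N -> ~ A (y k).

Lemma outer_limit_A : outer_limit A xs.
Proof.
move=> d /iterates_cvg[K KP]; exists (y (maxn K0 K)); first exact/nA/leq_maxl.
by have [] := KP _ (leq_maxr K0 K).
Qed.

Lemma outer_limit_B : outer_limit B xs.
Proof.
move=> d /iterates_cvg[K KP]; exists (x (maxn K0 K)); first exact/nB/leq_maxl.
by have [] := KP _ (leq_maxr K0 K).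
Qed.

Lemma outer_limit_bd (C : set 'rV[R]_n) : C xs -> outer_limit C xs -> bd C xs.
Proof.
move=> Cxs oC; split; first exact: subset_closure.
by move=> /interior_enorm[r r0 rC]; have [z nCz /rC] := oC r r0.
Qed.

Let al k := pdist A (y k).
Let be k := pdist B (x k).

(** Opposite normals confine the intersection to a common supporting hyperplane, and regularity
    makes it fill a disc there. Near [xs] the normals are then exactly [uA] and [- uA], and pairing
    the steps with [uA] gives equalities. *)
Lemma flat_distances uA uB : limit_normal A xs uA -> limit_normal B xs uB ->
  dotv uA uB = -1 -> regular_pair (bd A) (bd B) xs ->
  exists2 K, (K0 <= K)%N & forall k, (K <= k)%N ->
    al k = (a1 - 1) * be k /\ be k.+1 = (a2 - 1) * al k.
Proof.
move=> lA lB uAB [[|j] [// _ [UA [dA [FA [UB [dB [FB [UI [dI [FI [chA chB chI kerI]]]]]]]]]]]].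
have bA := outer_limit_bd Axs outer_limit_A.
have bB := outer_limit_bd Bxs outer_limit_B.
have [vA [kerA lA']] := chart_limit_normal cA sA bA chA.
have [vB [kerB lB']] := chart_limit_normal cB sB bB chB.
have uvA := limit_normal_unique outer_limit_A lA lA'.
have uvB := limit_normal_unique outer_limit_B lB lB'.
rewrite -uvA in kerA; rewrite -uvB in kerB.
have uA1 : enorm uA = 1 by case: lA.
have uBE : uB = - uA by apply: antipodal_unit => //; case: lB.
have supA z : A z -> dotv uA (z - xs) <= 0.
  exact: limit_normal_supports outer_limit_A lA.
have supB z : B z -> dotv uB (z - xs) <= 0.
  exact: limit_normal_supports outer_limit_B lB.
have clA : closed A by case: cA.
have clB : closed B by case: cB.
have kerI' : tker FI xs = [set v | dotv uA v = 0].
  rewrite kerI kerA kerB uBE; apply/seteqP; split=> v /=; first by case.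
  by move=> h; split => //; rewrite /= dotvNl h oppr0.
have flat z : A z -> B z -> dotv uA (z - xs) = 0.
  move=> /supA h1 /supB; rewrite uBE dotvNl oppr_le0 => h2.
  by apply/eqP; rewrite eq_le h1.
have [r r0 patch] := flat_patch clA clB bA bB chI uA1 kerI' flat.
have [v uAv /patch-/(_ uAv) []|d d0 dP] := limit_normal_flat cA Axs lA supA r0 _ => //.
have [v|d' d'0 d'P] := limit_normal_flat cB Bxs lB supB r0 _.
  by rewrite uBE dotvNl => /eqP; rewrite oppr_eq0 => /eqP/patch h /h[].
have m0 : 0 < Num.min d d' by rewrite lt_min d0.
have [K KP] := iterates_cvg m0.
have key k : (maxn K0 K <= k)%N -> [/\ pnormal A (y k) = uA,
    dotv uA (projC A (y k) - xs) = 0, pnormal B (x k) = - uA & dotv uA (projC B (x k) - xs) = 0].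
  rewrite geq_max => /andP[k0 /KP[]]; rewrite !lt_min => /andP[_ xd] /andP[yd _].
  have [p1 p2] := dP _ (nA k0) yd; have [p3 p4] := d'P _ (nB k0) xd.
  split => //; first by rewrite p3.
  by move: p4; rewrite uBE dotvNl => /eqP; rewrite oppr_eq0 => /eqP.
exists (maxn K0 K); first exact: leq_maxl.
move=> k Kk; have [p1 p2 p3 p4] := key k Kk; have [_ _ q3 q4] := key k.+1 (leqW Kk).
have k0 : (K0 <= k)%N by apply: leq_trans Kk; exact: leq_maxl.
have uu := dotv_unit uA1.
split.
  have := y_step cB a1 nB k0; rewrite -/(y k) -/(be k) p3 => e1.
  have := pnormalE cA (nA k0); rewrite -/(al k) p1 => e2.
  have : dotv uA (al k *: uA) = dotv uA ((projC B (x k) - xs) - (projC A (y k) - xs)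
      + ((a1 - 1) * be k) *: uA).
    by rewrite -e2 e1; congr (dotv _ _); apply/rowP => i; rewrite !mxE; ring.
  by rewrite dotvDr dotvBr p2 p4 !dotvZr uu; lra.
have := x_step cA xS nA k0; rewrite -/(y k) -/(al k) p1 => e1.
have := pnormalE cB (nB (leqW k0)); rewrite -/(be k.+1) q3 => e2.
have : dotv uA (be k.+1 *: - uA) = dotv uA ((projC A (y k) - xs) - (projC B (x k.+1) - xs)
    - ((a2 - 1) * al k) *: uA).
  by rewrite -e2 e1; congr (dotv _ _); apply/rowP => i; rewrite !mxE; ring.
by rewrite 2!dotvBr p2 q4 !dotvZr dotvNr uu; lra.
Qed.

Lemma local_rate : regular_pair (bd A) (bd B) xs ->
  forall UA dA (FA : 'rV[R]_n -> 'rV[R]_dA) UB dB (FB : 'rV[R]_n -> 'rV[R]_dB),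
  is_chart 2 (bd A) xs UA FA -> is_chart 2 (bd B) xs UB FB ->
  forall mu : R, gamma (mat_of (S_T a1 a2 (tker FA xs) (tker FB xs))) < mu < 1 ->
  exists C : R, 0 < C /\ forall k, enorm (x k - xs) <= C * mu ^+ k.
Proof.
move=> reg UA dA FA UB dB FB chA chB mu.
have bA := outer_limit_bd Axs outer_limit_A.
have bB := outer_limit_bd Bxs outer_limit_B.
have [uA [kerA lA]] := chart_limit_normal cA sA bA chA.
have [uB [kerB lB]] := chart_limit_normal cB sB bB chB.
rewrite kerA kerB => /andP[gmu mu1].
have mu0 : 0 < mu := le_lt_trans (gamma_ge0 _) gmu.
have uA1 : enorm uA = 1 by case: lA.
have uB1 : enorm uB = 1 by case: lB.
have [/andP[g1 l1] /andP[g2 l2]] := conj ha1 ha2.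
have al0 k : 0 <= al k by exact: pdist_ge0.
have al0' k : (K0 <= k)%N -> 0 < al k by move=> /nA; exact: pdist_gt0.
have be0' k : (K0 <= k)%N -> 0 < be k by move=> /nB; exact: pdist_gt0.
have [C [K [C0 KK0 decay beC]]] : exists C K, [/\ 0 < C, (K0 <= K)%N,
    forall k, (K <= k)%N -> al k.+1 <= mu * al k & forall k, (K <= k)%N -> be k <= C * al k].
  have := dotv_abs uA uB; rewrite uA1 uB1 mulr1 ler_norml => /andP[cm1 _].
  have [kap1|kap1] := ltP (- dotv uA uB) 1.
    (* The sequences are shifted by [K0], since the recursion lemma asks for positive distances at
       every index. *)
    have [||C [K [C0 h1 h2]]] := @coupled_recursion_decay R (fun k => al (K0 + k)%N)
      (fun k => be (K0 + k)%N) a1 a2 (- dotv uA uB) mu g1 g2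
      (fun k => al0' _ (leq_addr k K0)) (fun k => be0' _ (leq_addr k K0)) mu0.
    - move=> e e0.
      have [K KP] := distances_recursion cA cB ha1 ha2 xS nB nA iterates_cvg lA lB e0.
      exists K => k Kk; rewrite addnS; apply: KP.
      exact: leq_trans Kk (leq_addl _ _).
    - move=> l kap0 lmu; apply/eqP => lq; move: gmu; rewrite ltNge => /negP; apply.
      apply: (le_trans lmu); apply: gamma_ge_root => //; first by rewrite kap0.
      exact: lt_le_trans lmu.
    exists C, (K0 + K)%N; split => // [|k Kk|k Kk]; first exact: leq_addr.
      have := h1 (k - K0)%N; rewrite leq_subRL ?(leq_trans (leq_addr _ _) Kk)//.
      by rewrite addnS subnKC ?(leq_trans (leq_addr _ _) Kk)//; exact.
    have := h2 (k - K0)%N; rewrite leq_subRL ?(leq_trans (leq_addr _ _) Kk)//.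
    by rewrite subnKC ?(leq_trans (leq_addr _ _) Kk)//; exact.
  (* For [kap = 1] the quadratic has the root 1, above [mu], so the asymptotic recursion cannot give
     the rate and the exact one replaces it. *)
  have uAB : dotv uA uB = -1 by lra.
  have [K KK0 KP] := flat_distances lA lB uAB reg.
  have b10 : 0 < a1 - 1 by rewrite subr_gt0.
  exists (a1 - 1)^-1, K; split => //; first by rewrite invr_gt0.
    move=> k Kk; have [_ e2] := KP k Kk; have [e3 _] := KP k.+1 (leqW Kk).
    rewrite e3 e2 mulrA ler_wpM2r//.
    apply: (le_trans _ (ltW gmu)); apply: gamma_ge_antipodal => //.
    exact: antipodal_unit.
  by move=> k Kk; have [-> _] := KP k Kk; rewrite mulKf// gt_eqF.
have D0 : 0 <= a1 * C + a2 by have : 0 < a1 * C; [rewrite mulr_gt0//; lra|lra].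
have mu01 : 0 < mu < 1 by rewrite mu0.
have xM k : enorm (x k - xs) <= enorm (x 0%N - xs).
  exact: (gap_mono cA cB g1 l1 g2 l2 xS Axs Bxs (leq0n k)).
apply: (linear_rate mu01 al0 D0 xcv xM decay) => k Kk; have k0 := leq_trans KK0 Kk.
apply: (le_trans (step_bound cA cB ha1 ha2 xS nB nA k0)).
rewrite -/(al k) -/(be k) mulrDl lerD2r -mulrA ler_pM2l; last by lra.
exact: beC.
Qed.

End LocalRate.

Theorem theorem8 (R : realType) (n : nat) (A B : set 'rV[R]_n)
  (a1 a2 : R) (x : nat -> 'rV[R]_n) :
  closed A -> closed B -> solid A -> solid B ->
  convex_set A -> convex_set B -> A `&` B !=set0 ->
  1 < a1 < 2 -> 1 < a2 < 2 ->
  (forall k, x k.+1 = relax a2 (projC A) (relax a1 (projC B) (x k))) ->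
  exists xs : 'rV[R]_n,
    [/\ A xs, B xs, x @ \oo --> xs &
    (condC A B xs ->
      (exists k, A (x k) /\ B (x k)) \/
      [/\ bd A xs, bd B xs,
          (* eventual identification of (bd A, bd B) *)
          (exists K, forall k, (K <= k)%N ->
             exists p q : 'rV[R]_n,
               [/\ p = projC B (x k), is_proj (bd B) (x k) p,
                   q = projC A (relax a1 (projC B) (x k)),
                   is_proj (bd A) (relax a1 (projC B) (x k)) q &
                   x k.+1 = relax a2 (fun _ => q) (relax a1 (fun _ => p) (x k))]) &
          (* R-linear convergence with any rate mu in (gamma(S_T(xs)), 1) *)
          (forall UA dA (FA : 'rV[R]_n -> 'rV[R]_dA)
                  UB dB (FB : 'rV[R]_n -> 'rV[R]_dB),
             is_chart 2 (bd A) xs UA FA -> is_chart 2 (bd B) xs UB FB ->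
             forall mu : R,
               gamma (mat_of (S_T a1 a2 (tker FA xs) (tker FB xs))) < mu < 1 ->
               exists C : R, 0 < C /\
                 forall k, enorm (x k - xs) <= C * mu ^+ k)])].
Proof.
move=> clA clB sA sB vA vB AB0 ha1 ha2 xS.
have cA : closed_convex A by case: AB0 => z [Az _]; split => //; exists z.
have cB : closed_convex B by case: AB0 => z [_ Bz]; split => //; exists z.
have [/andP[g1 l1] /andP[g2 l2]] := conj ha1 ha2.
have [xs [Axs Bxs xcv]] := gap_cvg cA cB g1 l1 g2 l2 xS AB0.
exists xs; split => // hC.
have [absA absB] := condC_absorbs cA cB sA sB ha1 ha2 Axs Bxs hC.
have [fin|[K KP]] := finite_or_outside cA cB ha1 xS Bxs xcv absA absB; [by left|right].
have nB k (Kk : (K <= k)%N) : ~ B (x k) by case: (KP k Kk).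
have nA k (Kk : (K <= k)%N) : ~ A (relax a1 (projC B) (x k)) by case: (KP k Kk).
have bA := outer_limit_bd Axs (outer_limit_A cB ha1 Bxs xcv nA).
have bB := outer_limit_bd Bxs (outer_limit_B cB ha1 Bxs xcv nB).
(* Both boundary memberships are known by now, so the cases of condition (C) with an interior point
   are contradictory. *)
have reg : regular_pair (bd A) (bd B) xs.
  by case: hC => [[_ [_ //]]|[/bA.2 //]|[_ [/bB.2 //]]|[/bA.2 //]].
(* The nearest point of [C] from outside lies on [bd C], a subset of [C], and so remains nearest
   there. *)
have proj_bd (C : set 'rV[R]_n) z : closed_convex C -> ~ C z -> is_proj (bd C) z (projC C z).
  move=> cC nC; split; first exact: projC_bd.
  by move=> w [clw _]; apply: (projC_is_proj z cC).2; case: cC => clC _ _; exact: clC.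
split => //.
  exists K => k Kk; exists (projC B (x k)), (projC A (relax a1 (projC B) (x k))).
  by split => //; [exact/proj_bd/nB|exact/proj_bd/nA].
exact: (local_rate cA cB sA sB ha1 ha2 xS Axs Bxs xcv nB nA reg).
Qed.
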